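(* Let $p\ge1$ be an integer, let $\beta\in[0,1)$, and let $F(z)=\sum_{k=1}^{p}|z|^{2(k-1)}\big(h_k(z)+\overline{g_k(z)}\big)\in H_p^0$ be univalent in $\mathbb{U}$ and such that $\frac{\partial}{\partial\theta}F(re^{i\theta})\ne0$ for all $r\in(0,1)$ (and all $\theta\in\mathbb{R}$). Then $F$ is convex of order $\beta$ if and only if $$\sum_{k=1}^{p}|z|^{2(k-1)}\left\{h_k(z)\ast\left[\frac{(2-\beta\xi-\beta)z+(2\xi+\beta\xi+\beta)z^{2}}{(1-z)^{3}}\right]+\overline{g_k(z)}\ast\left[\frac{(2\xi+\beta\xi+\beta)\overline{z}+(2-\beta\xi-\beta)\overline{z}^{2}}{(1-\overline{z})^{3}}\right]\right\}\neq0$$ for all $z\in\mathbb{U}$ with $z\neq0$ and all $\xi\in\mathbb{C}$ with $|\xi|=1$.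
   Context: $\mathbb{U}=\{z\in\mathbb{C}:|z|<1\}$. A $2p$ times continuously differentiable complex-valued mapping $F$ is polyharmonic (or $p$-harmonic) if $\Delta^pF=0$, where $\Delta=4\,\partial^2/\partial z\,\partial\overline z$. $H_p$ is the set of all polyharmonic mappings $F$ in $\mathbb{U}$ with a series expansion of the form $$F(z)=\sum_{k=1}^{p}|z|^{2(k-1)}\big(h_k(z)+\overline{g_k(z)}\big)=\sum_{k=1}^{p}|z|^{2(k-1)}\sum_{j=1}^{\infty}\left(a_{k,j}z^{j}+\overline{b_{k,j}}\,\overline{z}^{\,j}\right),$$ where $h_k(z)=\sum_{j\ge1}a_{k,j}z^j$ and $g_k(z)=\sum_{j\ge1}b_{k,j}z^j$ are analytic in $\mathbb{U}$, $a_{1,1}=1$ and $|b_{1,1}|<1$. $H_p^0$ is the subclass of $H_p$ with $b_{1,1}=0$ and $a_{k,1}=b_{k,1}=0$ for $k\in\{2,\dots,p\}$. The symbol $\ast$ is the convolution (Hadamard product): $\sum_j a_jz^j\ast\sum_j c_jz^j=\sum_j a_jc_jz^j$, and likewise $\sum_j \overline{b_j}\,\overline z^{\,j}\ast\sum_j d_j\overline z^{\,j}=\sum_j \overline{b_j}\,d_j\,\overline z^{\,j}$ for series in $\overline z$. A univalent (injective) polyharmonic mapping $F$ with $F(0)=0$ and $\frac{\partial}{\partial\theta}F(re^{i\theta})\ne0$ whenever $r\in(0,1)$ is convex of order $\beta\in[0,1)$ if $$\frac{\partial}{\partial\theta}\left[\arg\left(\frac{\partial}{\partial\theta}F(re^{i\theta})\right)\right]=\operatorname{Re}\left\{\frac{zF_z(z)+z^2F_{zz}(z)-2|z|^2F_{z\overline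 z}(z)+\overline zF_{\overline z}(z)+\overline z^{2}F_{\overline z\,\overline z}(z)}{zF_z(z)-\overline zF_{\overline z}(z)}\right\}>\beta$$ for all $z=re^{i\theta}\neq0$ in $\mathbb{U}$. *)

(* Defs.v *)
(* Stdlib reals with Coquelicot (complex numbers C, Derive, Series, is_pseries). *)
From Stdlib Require Import Reals ClassicalEpsilon.
From Coquelicot Require Import Coquelicot.

Local Open Scope C_scope.

Definition in_disk (z : C) : Prop := (Cmod z < 1)%R.

Definition ex_curve_derive (f : R -> C) (t : R) : Prop :=
  ex_derive (fun s => Re (f s)) t /\ ex_derive (fun s => Im (f s)) t.

Definition curve_derive (f : R -> C) (t : R) : C :=
  (Derive (fun s => Re (f s)) t, Derive (fun s => Im (f s)) t).

Definition ex_partial_x (F : C -> C) (z : C) : Prop :=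
  ex_curve_derive (fun t => F (t, Im z)) (Re z).
Definition ex_partial_y (F : C -> C) (z : C) : Prop :=
  ex_curve_derive (fun t => F (Re z, t)) (Im z).

Definition partial_x (F : C -> C) (z : C) : C :=
  curve_derive (fun t => F (t, Im z)) (Re z).
Definition partial_y (F : C -> C) (z : C) : C :=
  curve_derive (fun t => F (Re z, t)) (Im z).

(* Wirtinger derivatives F_z and F_{\bar z}. *)
Definition Dz (F : C -> C) (z : C) : C := (partial_x F z - Ci * partial_y F z) / 2.
Definition Dzb (F : C -> C) (z : C) : C := (partial_x F z + Ci * partial_y F z) / 2.

Definition laplacian (F : C -> C) (z : C) : C := 4 * Dzb (Dz F) z.

(* n times continuously differentiable, in the real sense, on the disk. *)
Fixpoint Cn_on_disk (n : nat) (F : C -> C) : Prop :=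
  match n with
  | O => forall z, in_disk z ->
           continuous (T := C_UniformSpace) (U := C_UniformSpace) F z
  | S m => (forall z, in_disk z -> ex_partial_x F z /\ ex_partial_y F z)
           /\ Cn_on_disk m (partial_x F) /\ Cn_on_disk m (partial_y F)
  end.

Definition polyharmonic (p : nat) (F : C -> C) : Prop :=
  Cn_on_disk (2 * p) F /\
  forall z, in_disk z -> Nat.iter p laplacian F z = 0.

(* f(z) = sum_j a_j w(z)^j on the disk.  With w the identity this is a power
   series in z, with w = Cconj a power series in \bar z. *)
Definition has_expansion (w : C -> C) (f : C -> C) (a : nat -> C) : Prop :=
  forall z, in_disk z ->
    is_pseries (K := C_AbsRing) (V := C_NormedModule) a (w z) (f z).

(* The coefficients of f as a series in w; meaningful when such an expansion
   exists (it is then unique, for w the identity or Cconj). *)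
Definition coeffs (w : C -> C) (f : C -> C) : nat -> C :=
  epsilon (inhabits (fun _ : nat => RtoC 0)) (has_expansion w f).

Definition CSeries (u : nat -> C) : C :=
  (Series (fun n => Re (u n)), Series (fun n => Im (u n))).

Definition convolution_in (w : C -> C) (f g : C -> C) (z : C) : C :=
  CSeries (fun j => coeffs w f j * coeffs w g j * w z ^ j).

(* Hadamard products of series in z and of series in \bar z. *)
Definition convolution : (C -> C) -> (C -> C) -> C -> C :=
  convolution_in (fun z => z).
Definition conj_convolution : (C -> C) -> (C -> C) -> C -> C :=
  convolution_in Cconj.

Definition sum_1_to (p : nat) (u : nat -> C) : C :=
  sum_n_m (G := C_AbelianGroup) u 1 p.

(* F belongs to H_p, with components h k, g k and coefficients a k j, b k j
   (1 <= k <= p, j >= 1).  The series start at j = 1, encoded by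
   a k 0 = b k 0 = 0; values at other indices k are irrelevant. *)
Definition in_H (p : nat) (F : C -> C) (h g : nat -> C -> C)
    (a b : nat -> nat -> C) : Prop :=
  polyharmonic p F
  /\ (forall k, (1 <= k <= p)%nat ->
        a k O = 0 /\ b k O = 0
        /\ has_expansion (fun z => z) (h k) (a k)
        /\ has_expansion (fun z => z) (g k) (b k))
  /\ (forall z, in_disk z ->
        F z = sum_1_to p (fun k =>
                RtoC (Cmod z ^ (2 * (k - 1))) * (h k z + Cconj (g k z))))
  /\ a 1%nat 1%nat = 1
  /\ (Cmod (b 1%nat 1%nat) < 1)%R.

Definition in_H0 (p : nat) (F : C -> C) (h g : nat -> C -> C)
    (a b : nat -> nat -> C) : Prop :=
  in_H p F h g a b
  /\ b 1%nat 1%nat = 0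
  /\ (forall k, (2 <= k <= p)%nat -> a k 1%nat = 0 /\ b k 1%nat = 0).

Definition univalent (F : C -> C) : Prop :=
  forall z w, in_disk z -> in_disk w -> F z = F w -> z = w.

Definition polar (r theta : R) : C := (r * cos theta, r * sin theta)%R.

Definition Dtheta_nonvanishing (F : C -> C) : Prop :=
  forall r theta : R, (0 < r < 1)%R ->
    curve_derive (fun t => F (polar r t)) theta <> 0.

(* The derivative with respect to theta of arg (d/dtheta F(r e^{i theta})), at
   z = r e^{i theta}, given by its single-valued expression. *)
Definition tangent_rotation (F : C -> C) (z : C) : R :=
  Re ((z * Dz F z + z ^ 2 * Dz (Dz F) z
         - 2 * RtoC (Cmod z ^ 2) * Dzb (Dz F) z
         + Cconj z * Dzb F z + Cconj z ^ 2 * Dzb (Dzb F) z)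
      / (z * Dz F z - Cconj z * Dzb F z)).

Definition convex_of_order (p : nat) (beta : R) (F : C -> C) : Prop :=
  polyharmonic p F /\ univalent F /\ F 0 = 0 /\ Dtheta_nonvanishing F
  /\ forall z, in_disk z -> z <> 0 -> (tangent_rotation F z > beta)%R.

(* Main.v *)
(* Write N and D for the numerator and the denominator of the tangent rotation.
   On a circle |z| = r they are, up to the factors -1 and i, the second and first
   derivatives of F in the angle; there |z|^(2(k-1)) is constant, so both come
   from the expansion of F by multiplying coefficients by j^2 and j.  The kernels
   have coefficients (1 + xi) j^2 +- ((1 - xi) - beta (1 + xi)) j, hence the
   convolution sum equals (1 + xi) (N - beta D) + (1 - xi) D.  As xi runs over the
   unit circle, (xi - 1) / (xi + 1) runs over the imaginary axis, so the sum never
   vanishes iff Re (N / D) is never beta.  Since N / D tends to 1 > beta at the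
   origin along every ray, this is equivalent to Re (N / D) > beta. *)

Require Import Defs.
From Stdlib Require Import Reals Lra Lia ClassicalEpsilon.
From Coquelicot Require Import Coquelicot.

Local Open Scope C_scope.

(** The derivatives in the statement are total functions built from real partial derivatives, so
    they can only be computed once differentiability is known, and [Dz (Dz F)] needs [Dz F] on a
    whole neighbourhood. Everything is therefore computed from the expansion: absolute convergence
    gives power sums a quadratic Taylor remainder, hence a chain rule along curves, hence all
    Wirtinger derivatives. The convolution hides a choice of coefficients; uniqueness of expansions
    identifies them. The value xi = -1 is missing from the parametrisation of the imaginary axis,
    but the convolution sum is then 2 D, and D does not vanish because the angular derivative of F
    does not. At the origin N / D is 0 / 0. On a ray t z both are divided by t first; the new
    quotient is continuous on all of [0, 1] and equals 1 at t = 0, because the coefficients of z and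
    of its conjugate in F are 1 and 0 there. *)

Lemma Ceq_re_im (x y : C) : Re x = Re y -> Im x = Im y -> x = y.
Proof. destruct x, y; simpl; intros; f_equal; assumption. Qed.

Lemma Cmod_le_re_im (z : C) : (Cmod z <= Rabs (Re z) + Rabs (Im z))%R.
Proof.
  apply Rsqr_incr_0_var; [| apply Rplus_le_le_0_compat; apply Rabs_pos].
  unfold Rsqr. replace (Cmod z * Cmod z)%R with (Cmod z ^ 2)%R by ring.
  rewrite Cmod2_alt, <- (pow2_abs (Re z)), <- (pow2_abs (Im z)).
  pose proof (Rabs_pos (Re z)). pose proof (Rabs_pos (Im z)). nra.
Qed.

Lemma im_le_Cmod (z : C) : (Rabs (Im z) <= Cmod z)%R.
Proof. eapply Rle_trans; [apply Rmax_r | apply Rmax_Cmod]. Qed.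

Lemma Ci_sqr : Ci * Ci = - (1).
Proof. apply Ceq_re_im; simpl; ring. Qed.

Lemma Cconj_Ci : Cconj Ci = - Ci.
Proof. apply Ceq_re_im; simpl; ring. Qed.

Lemma Cconj_RtoC (x : R) : Cconj (RtoC x) = RtoC x.
Proof. apply Ceq_re_im; simpl; ring. Qed.

(** * Complex series and power series *)

(** Convergence by components matches [CSeries] and gives access to the theory of real series. *)
Definition is_csum (u : nat -> C) (l : C) : Prop :=
  is_series (fun n => Re (u n)) (Re l) /\ is_series (fun n => Im (u n)) (Im l).

Lemma CSeries_unique (u : nat -> C) (l : C) : is_csum u l -> CSeries u = l.
Proof.
  intros [H1 H2]. unfold CSeries.
  apply Ceq_re_im; simpl; now apply is_series_unique.
Qed.

Lemma CSeries_ext (u v : nat -> C) :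
  (forall n, u n = v n) -> CSeries u = CSeries v.
Proof.
  intros E. unfold CSeries. f_equal; apply Series_ext; intros n; now rewrite E.
Qed.

Lemma is_csum_ext (u v : nat -> C) (l : C) :
  (forall n, u n = v n) -> is_csum u l -> is_csum v l.
Proof.
  intros E [H1 H2]; split; eapply is_series_ext; try eassumption;
    intros n; simpl; now rewrite E.
Qed.

Lemma is_csum_plus (u v : nat -> C) (l m : C) :
  is_csum u l -> is_csum v m -> is_csum (fun n => u n + v n) (l + m).
Proof.
  intros [H1 H2] [H3 H4]; split.
  - rewrite re_plus.
    eapply is_series_ext; [|exact (is_series_plus _ _ _ _ H1 H3)].
    intros n; now rewrite re_plus.
  - rewrite im_plus.
    eapply is_series_ext; [|exact (is_series_plus _ _ _ _ H2 H4)].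
    intros n; now rewrite im_plus.
Qed.

Lemma is_csum_scal (c : C) (u : nat -> C) (l : C) :
  is_csum u l -> is_csum (fun n => c * u n) (c * l).
Proof.
  intros [H1 H2]; split.
  - rewrite re_mult.
    eapply is_series_ext;
      [|exact (is_series_minus _ _ _ _ (is_series_scal (Re c) _ _ H1)
                 (is_series_scal (Im c) _ _ H2))].
    intros n; rewrite re_mult; reflexivity.
  - rewrite im_mult.
    eapply is_series_ext;
      [|exact (is_series_plus _ _ _ _ (is_series_scal (Re c) _ _ H2)
                 (is_series_scal (Im c) _ _ H1))].
    intros n; rewrite im_mult; reflexivity.
Qed.

Lemma is_csum_minus (u v : nat -> C) (l m : C) :
  is_csum u l -> is_csum v m -> is_csum (fun n => u n - v n) (l - m).
Proof.
  intros H1 H2. replace (l - m) with (l + (-1) * m) by ring.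
  eapply is_csum_ext; [|exact (is_csum_plus _ _ _ _ H1 (is_csum_scal (-1) _ _ H2))].
  intros n; simpl; ring.
Qed.

Lemma is_csum_conj (u : nat -> C) (l : C) :
  is_csum u l -> is_csum (fun n => Cconj (u n)) (Cconj l).
Proof.
  intros [H1 H2]; split.
  - rewrite re_conj. eapply is_series_ext; [|exact H1].
    intros n; now rewrite re_conj.
  - rewrite im_conj. eapply is_series_ext; [|exact (is_series_opp _ _ H2)].
    intros n; now rewrite im_conj.
Qed.

Lemma is_csum_decr (u : nat -> C) (l : C) :
  is_csum (fun n => u (S n)) l -> is_csum u (u O + l).
Proof.
  intros [H1 H2]; split.
  - rewrite re_plus. apply is_series_decr_1.
    match goal with |- is_series _ ?x => replace x with (Re l) end; [exact H1|].
    unfold plus, opp; simpl; ring.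
  - rewrite im_plus. apply is_series_decr_1.
    match goal with |- is_series _ ?x => replace x with (Im l) end; [exact H2|].
    unfold plus, opp; simpl; ring.
Qed.

Lemma is_series_nonneg (v : nat -> R) (s : R) :
  (forall n, 0 <= v n)%R -> is_series v s -> (0 <= s)%R.
Proof.
  intros Hv Hs.
  refine (is_lim_seq_le (fun _ => 0%R) (sum_n v) 0 s _ (is_lim_seq_const 0) Hs).
  intros n. induction n as [|n IH]; [rewrite sum_O; apply Hv|].
  rewrite sum_Sn. specialize (Hv (S n)). unfold plus; simpl. lra.
Qed.

(* Pairing the series with the conjugate of its sum makes the terms real. *)
Lemma is_csum_norm_le (u : nat -> C) (l : C) (v : nat -> R) (s : R) :
  is_csum u l -> (forall n, (Cmod (u n) <= v n)%R) -> is_series v s ->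
  (Cmod l <= s)%R.
Proof.
  intros Hu Huv Hv.
  assert (Hs : (0 <= s)%R).
  { apply (is_series_nonneg v); [|exact Hv].
    intros n. eapply Rle_trans; [apply Cmod_ge_0 | apply Huv]. }
  destruct (Rle_lt_or_eq_dec 0 (Cmod l) (Cmod_ge_0 l)) as [Hl | Hl]; [|lra].
  apply Rmult_le_reg_l with (1 := Hl).
  destruct (is_csum_scal (Cconj l) _ _ Hu) as [H _].
  replace (Re (Cconj l * l)) with (Cmod l * Cmod l)%R in H.
  2:{ replace (Cmod l * Cmod l)%R with (Cmod l ^ 2)%R by ring.
      rewrite Cmod2_alt. destruct l; simpl; ring. }
  assert (Hn : is_series (fun n => Cmod l * v n - Re (Cconj l * u n))%R
                 (Cmod l * s - Cmod l * Cmod l)%R).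
  { exact (is_series_minus _ _ _ _ (is_series_scal (Cmod l) _ _ Hv) H). }
  assert (0 <= Cmod l * s - Cmod l * Cmod l)%R; [|lra].
  apply (is_series_nonneg _ _) with (2 := Hn).
  intros n.
  assert (Re (Cconj l * u n) <= Cmod l * v n)%R; [|lra].
  eapply Rle_trans; [apply Rle_abs|].
  eapply Rle_trans; [apply re_le_Cmod|].
  rewrite Cmod_mult, Cmod_conj.
  apply Rmult_le_compat_l; [apply Cmod_ge_0 | apply Huv].
Qed.

Lemma pow_n_Cpow (z : C) (n : nat) : pow_n (K := C_Ring) z n = z ^ n.
Proof. induction n as [|n IH]; simpl; [reflexivity | now rewrite IH]. Qed.

Lemma sum_n_re_im (u : nat -> C) (n : nat) :
  sum_n (G := C_AbelianGroup) u n =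
  (sum_n (fun k => Re (u k)) n, sum_n (fun k => Im (u k)) n).
Proof.
  induction n as [|n IH].
  - rewrite !sum_O. now destruct (u O).
  - rewrite !sum_Sn, IH. reflexivity.
Qed.

(** The uniform structure on C is that of a product, so a ball is a pair of real balls and the limit
    splits into two real limits. *)
Lemma is_pseries_csum (a : nat -> C) (z l : C) :
  is_pseries (K := C_AbsRing) (V := C_NormedModule) a z l
  <-> is_csum (fun n => a n * z ^ n) l.
Proof.
  assert (E : forall n, sum_n (G := C_AbelianGroup)
                (fun k => scal (V := C_NormedModule) (pow_n (K := C_AbsRing) z k) (a k)) n
              = (sum_n (fun k => Re (a k * z ^ k)) n,
                 sum_n (fun k => Im (a k * z ^ k)) n)).
  { intros n. rewrite <- sum_n_re_im. apply sum_n_ext. intros k.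
    change (pow_n (K := C_Ring) z k * a k = a k * z ^ k).
    rewrite pow_n_Cpow. ring. }
  split.
  - intros H.
    split; apply filterlim_locally; intros eps;
      pose proof (proj1 (filterlim_locally _ _) H eps) as [N HN];
      exists N; intros n Hn; specialize (HN n Hn); rewrite E in HN; apply HN.
  - intros [H1 H2]. apply filterlim_locally; intros eps.
    pose proof (proj1 (filterlim_locally _ _) H1 eps) as [N1 HN1].
    pose proof (proj1 (filterlim_locally _ _) H2 eps) as [N2 HN2].
    exists (max N1 N2). intros n Hn.
    rewrite E. split; [apply HN1 | apply HN2]; lia.
Qed.

(** Absolute convergence on every smaller circle is a condition on the moduli of the coefficients
    alone, so it passes easily to shifted, added or [euler]-weighted coefficients. *)
Definition summable_disk (a : nat -> C) : Prop :=
  forall rho : R, (0 <= rho < 1)%R -> ex_series (fun n => Cmod (a n) * rho ^ n)%R.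

Lemma summable_disk_le (a b : nat -> C) (K : R) :
  (forall n, Cmod (b n) <= K * Cmod (a n))%R -> summable_disk a -> summable_disk b.
Proof.
  intros H Ha rho Hr.
  apply (ex_series_le (V := R_CompleteNormedModule) _
           (fun n => K * (Cmod (a n) * rho ^ n))%R).
  - intros n. change (Rabs (Cmod (b n) * rho ^ n) <= K * (Cmod (a n) * rho ^ n))%R.
    assert (0 <= rho ^ n)%R by (apply pow_le; lra).
    rewrite Rabs_pos_eq by (apply Rmult_le_pos; [apply Cmod_ge_0 | assumption]).
    rewrite <- Rmult_assoc. now apply Rmult_le_compat_r.
  - exact (ex_series_scal (V := R_NormedModule) K _ (Ha rho Hr)).
Qed.

Lemma summable_disk_plus (a b : nat -> C) :
  summable_disk a -> summable_disk b -> summable_disk (fun n => a n + b n).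
Proof.
  intros Ha Hb rho Hr.
  apply (ex_series_le (V := R_CompleteNormedModule) _
           (fun n => Cmod (a n) * rho ^ n + Cmod (b n) * rho ^ n)%R).
  - intros n.
    change (Rabs (Cmod (a n + b n) * rho ^ n) <= Cmod (a n) * rho ^ n + Cmod (b n) * rho ^ n)%R.
    assert (0 <= rho ^ n)%R by (apply pow_le; lra).
    rewrite Rabs_pos_eq by (apply Rmult_le_pos; [apply Cmod_ge_0 | assumption]).
    rewrite <- Rmult_plus_distr_r. apply Rmult_le_compat_r; [assumption | apply Cmod_triangle].
  - exact (ex_series_plus (V := R_NormedModule) _ _ (Ha rho Hr) (Hb rho Hr)).
Qed.

Lemma summable_disk_scal (c : C) (a : nat -> C) :
  summable_disk a -> summable_disk (fun n => c * a n).
Proof.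
  apply summable_disk_le with (K := Cmod c). intros n. rewrite Cmod_mult. lra.
Qed.

Lemma ex_series_terms_bounded (u : nat -> R) :
  ex_series u -> exists M, forall n, (Rabs (u n) <= M)%R.
Proof.
  intros H. pose proof (ex_series_lim_0 _ H) as L.
  destruct (proj1 (filterlim_locally _ _) L (mkposreal 1 Rlt_0_1)) as [N HN].
  assert (B : forall m, exists M, forall n, (n < m)%nat -> (Rabs (u n) <= M)%R).
  { induction m as [|m [M HM]]; [exists 0%R; intros; lia|].
    exists (Rmax M (Rabs (u m))). intros n Hn.
    destruct (Nat.eq_dec n m) as [->|]; [apply Rmax_r|].
    eapply Rle_trans; [apply HM; lia | apply Rmax_l]. }
  destruct (B N) as [M HM]. exists (Rmax M 1). intros n.
  destruct (Nat.lt_ge_cases n N) as [Hn|Hn].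
  - eapply Rle_trans; [now apply HM | apply Rmax_l].
  - specialize (HN n Hn). change (Rabs (u n - 0) < 1)%R in HN.
    rewrite Rminus_0_r in HN. eapply Rle_trans; [left; exact HN | apply Rmax_r].
Qed.

(** Abel's argument: convergence at a radius [rho'] strictly between [rho] and 1 bounds the terms
    there, and at [rho] they are then dominated by a geometric series of ratio [rho / rho']. *)
Lemma expansion_summable (f : C -> C) (a : nat -> C) :
  has_expansion (fun z => z) f a -> summable_disk a.
Proof.
  intros H rho Hr.
  set (rho' := ((1 + rho) / 2)%R).
  assert (Hr' : (rho < rho' < 1)%R) by (unfold rho'; lra).
  assert (Hd : in_disk (RtoC rho')).
  { unfold in_disk. rewrite Cmod_R, Rabs_pos_eq; lra. }
  destruct (proj1 (is_pseries_csum _ _ _) (H _ Hd)) as [H1 H2].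
  destruct (ex_series_terms_bounded _ (ex_intro _ _ H1)) as [M1 HM1].
  destruct (ex_series_terms_bounded _ (ex_intro _ _ H2)) as [M2 HM2].
  apply (ex_series_le (V := R_CompleteNormedModule) _
           (fun n => (M1 + M2) * (rho / rho') ^ n)%R).
  - intros n. change (Rabs (Cmod (a n) * rho ^ n) <= (M1 + M2) * (rho / rho') ^ n)%R.
    assert (0 <= rho ^ n)%R by (apply pow_le; lra).
    assert (0 < rho' ^ n)%R by (apply pow_lt; lra).
    rewrite Rabs_pos_eq by (apply Rmult_le_pos; [apply Cmod_ge_0 | assumption]).
    unfold Rdiv. rewrite Rpow_mult_distr, pow_inv.
    assert (Cmod (a n) * rho' ^ n <= M1 + M2)%R.
    { pose proof (Cmod_le_re_im (a n * RtoC rho' ^ n)) as B.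
      rewrite Cmod_mult, Cmod_pow, Cmod_R, (Rabs_pos_eq rho') in B by lra.
      specialize (HM1 n). specialize (HM2 n). cbv beta in HM1, HM2. lra. }
    apply Rle_trans with (Cmod (a n) * rho' ^ n * (rho ^ n * / rho' ^ n))%R.
    + right. field. lra.
    + apply Rmult_le_compat_r; [|assumption].
      apply Rmult_le_pos; [assumption | left; now apply Rinv_0_lt_compat].
  - apply (ex_series_scal (V := R_NormedModule)).
    apply ex_series_geom. rewrite Rabs_pos_eq.
    + apply Rmult_lt_reg_r with rho'; [lra|].
      unfold Rdiv. rewrite Rmult_assoc, Rinv_l; lra.
    + apply Rmult_le_pos; [lra | left; apply Rinv_0_lt_compat; lra].
Qed.

(** Coefficients of z f'(z). On a circle, z d/dz acts on analytic functions as -i d/dtheta. *)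
Definition euler (a : nat -> C) (n : nat) : C := RtoC (INR n) * a n.

Definition cderive (a : nat -> C) (n : nat) : C := RtoC (INR (S n)) * a (S n).

(** This trades a factor n for a slightly larger radius. It reflects the factorisation of rho'^n -
    rho^n by rho' - rho, whose cofactor has n terms, each at least rho^(n-1). *)
Lemma INR_pow_le (rho rho' : R) (n : nat) :
  (0 <= rho <= 1)%R -> (rho < rho')%R ->
  (INR n * rho ^ n * (rho' - rho) <= rho' ^ n)%R.
Proof.
  intros H1 H2.
  cut (INR n * rho ^ n * (rho' - rho) <= rho * rho' ^ n)%R.
  { intros H. assert (0 <= rho' ^ n)%R by (apply pow_le; lra). nra. }
  induction n as [|n IH]; [simpl; lra|].
  rewrite S_INR. simpl pow.
  assert (0 <= rho ^ n <= rho' ^ n)%R by (split; [apply pow_le | apply pow_incr]; lra).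
  assert (rho * (INR n * rho ^ n * (rho' - rho)) <= rho * (rho * rho' ^ n))%R
    by (apply Rmult_le_compat_l; lra).
  assert (rho * (rho' - rho) * rho ^ n <= rho * (rho' - rho) * rho' ^ n)%R.
  { apply Rmult_le_compat_l; [apply Rmult_le_pos|]; lra. }
  nra.
Qed.

Lemma summable_disk_euler (a : nat -> C) : summable_disk a -> summable_disk (euler a).
Proof.
  intros Ha rho Hr.
  set (rho' := ((1 + rho) / 2)%R).
  assert (Hr' : (rho < rho' < 1)%R) by (unfold rho'; lra).
  apply (ex_series_le (V := R_CompleteNormedModule) _
           (fun n => / (rho' - rho) * (Cmod (a n) * rho' ^ n))%R).
  - intros n.
    change (Rabs (Cmod (euler a n) * rho ^ n) <= / (rho' - rho) * (Cmod (a n) * rho' ^ n))%R.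
    assert (0 <= rho ^ n)%R by (apply pow_le; lra).
    rewrite Rabs_pos_eq by (apply Rmult_le_pos; [apply Cmod_ge_0 | assumption]).
    unfold euler. rewrite Cmod_mult, Cmod_R, Rabs_pos_eq by apply pos_INR.
    pose proof (INR_pow_le rho rho' n) as B.
    apply Rmult_le_reg_l with (rho' - rho)%R; [lra|].
    rewrite <- (Rmult_assoc (rho' - rho) (/ _)), Rinv_r, Rmult_1_l by lra.
    pose proof (Cmod_ge_0 (a n)).
    replace ((rho' - rho) * (INR n * Cmod (a n) * rho ^ n))%R
      with (Cmod (a n) * (INR n * rho ^ n * (rho' - rho)))%R by ring.
    apply Rmult_le_compat_l; [assumption | apply B; lra].
  - apply (ex_series_scal (V := R_NormedModule)). apply Ha. lra.
Qed.

Lemma summable_disk_cderive (a : nat -> C) : summable_disk a -> summable_disk (cderive a).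
Proof.
  intros Ha rho Hr.
  (* The midpoint is positive even for [rho = 0], so the index shift may divide by it. *)
  set (rho' := ((1 + rho) / 2)%R).
  assert (Hr' : (rho <= rho' < 1 /\ 0 < rho')%R) by (unfold rho'; lra).
  apply (ex_series_le (V := R_CompleteNormedModule) _
           (fun n => / rho' * (Cmod (euler a (S n)) * rho' ^ S n))%R).
  - intros n.
    change (Rabs (Cmod (cderive a n) * rho ^ n)
            <= / rho' * (Cmod (cderive a n) * (rho' * rho' ^ n)))%R.
    assert (0 <= rho ^ n <= rho' ^ n)%R by (split; [apply pow_le | apply pow_incr]; lra).
    pose proof (Cmod_ge_0 (cderive a n)).
    rewrite Rabs_pos_eq by (apply Rmult_le_pos; lra).
    replace (/ rho' * (Cmod (cderive a n) * (rho' * rho' ^ n)))%R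
      with (Cmod (cderive a n) * rho' ^ n)%R by (field; lra).
    apply Rmult_le_compat_l; lra.
  - apply (ex_series_scal (V := R_NormedModule)).
    apply (ex_series_incr_1 (fun n => Cmod (euler a n) * rho' ^ n)%R).
    apply (summable_disk_euler a Ha). lra.
Qed.

(** * Sums of power series and their quadratic remainder *)

Definition psum (a : nat -> C) (z : C) : C := CSeries (fun n => a n * z ^ n).

Lemma psum_correct (a : nat -> C) (z : C) :
  summable_disk a -> in_disk z -> is_csum (fun n => a n * z ^ n) (psum a z).
Proof.
  intros Ha Hz.
  assert (H : ex_series (fun n => Cmod (a n) * Cmod z ^ n)%R).
  { apply Ha. split; [apply Cmod_ge_0 | exact Hz]. }
  split; apply Series_correct.
  - eapply (ex_series_le (V := R_CompleteNormedModule)); [|exact H].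
    intros n. eapply Rle_trans; [apply re_le_Cmod|].
    rewrite Cmod_mult, Cmod_pow. apply Rle_refl.
  - eapply (ex_series_le (V := R_CompleteNormedModule)); [|exact H].
    intros n. eapply Rle_trans; [apply im_le_Cmod|].
    rewrite Cmod_mult, Cmod_pow. apply Rle_refl.
Qed.

Lemma psum_unique (f : C -> C) (a : nat -> C) (z : C) :
  has_expansion (fun z => z) f a -> in_disk z -> f z = psum a z.
Proof.
  intros H Hz. symmetry. apply CSeries_unique. now apply is_pseries_csum, H.
Qed.

Lemma psum_decr (a : nat -> C) (z : C) :
  summable_disk (fun n => a (S n)) -> in_disk z ->
  psum a z = a O + z * psum (fun n => a (S n)) z.
Proof.
  intros Ha Hz. apply CSeries_unique.
  replace (a O) with (a O * z ^ O) by (simpl; ring).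
  apply (is_csum_decr (fun n => a n * z ^ n)).
  eapply is_csum_ext; [|exact (is_csum_scal z _ _ (psum_correct _ z Ha Hz))].
  intros n; simpl; ring.
Qed.

Lemma psum_euler (a : nat -> C) (z : C) :
  summable_disk a -> in_disk z -> psum (euler a) z = z * psum (cderive a) z.
Proof.
  intros Ha Hz. rewrite psum_decr; [|exact (summable_disk_cderive a Ha) | exact Hz].
  change (fun n => euler a (S n)) with (cderive a).
  unfold euler at 1. simpl. ring.
Qed.

(** The remainders e_n satisfy e_(n+1) = w e_n + (w - z)^2 n z^(n-1), and n^2 + n is at most
    (n+1)^2. The factor [rho ^ 2] on the left avoids the exponent n - 2, and n^2 is the weight that
    two uses of [euler] put on a coefficient. *)
Lemma pow_remainder_le (z w : C) (rho : R) (n : nat) :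
  (Cmod z <= rho)%R -> (Cmod w <= rho)%R ->
  (rho ^ 2 * Cmod (w ^ n - z ^ n - (w - z) * (RtoC (INR n) * z ^ pred n))
   <= INR n ^ 2 * rho ^ n * Cmod (w - z) ^ 2)%R.
Proof.
  intros Hz Hw.
  assert (Hr : (0 <= rho)%R) by (eapply Rle_trans; [apply Cmod_ge_0 | exact Hz]).
  (* This also holds for [m = 0], where [pred 0 = 0] is harmless because the factor [INR 0] kills
     the term. *)
  assert (E : forall m, z * (RtoC (INR m) * z ^ pred m) = RtoC (INR m) * z ^ m).
  { intros [|m]; simpl pred; [simpl|rewrite Cpow_S]; ring. }
  assert (Hx : forall m, (rho * Cmod (RtoC (INR m) * z ^ pred m) <= INR m * rho ^ m)%R).
  { intros m. rewrite Cmod_mult, Cmod_R, Rabs_pos_eq, Cmod_pow by apply pos_INR.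
    destruct m as [|m]; [simpl; lra|].
    simpl pred. simpl pow.
    assert (0 <= Cmod z ^ m <= rho ^ m)%R.
    { split; [apply pow_le; apply Cmod_ge_0 | apply pow_incr].
      split; [apply Cmod_ge_0 | assumption]. }
    pose proof (pos_INR (S m)).
    replace (rho * (INR (S m) * Cmod z ^ m))%R with (INR (S m) * rho * Cmod z ^ m)%R by ring.
    rewrite <- Rmult_assoc. apply Rmult_le_compat_l; [|lra].
    now apply Rmult_le_pos. }
  induction n as [|n IH].
  - simpl. replace (_ - _ - _) with (RtoC 0) by ring. rewrite Cmod_0. lra.
  - set (e := w ^ n - z ^ n - (w - z) * (RtoC (INR n) * z ^ pred n)) in *.
    replace (w ^ S n - z ^ S n - (w - z) * (RtoC (INR (S n)) * z ^ pred (S n)))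
      with (w * e + (w - z) * (w - z) * (RtoC (INR n) * z ^ pred n)).
    2:{ transitivity (w * w ^ n - w * z ^ n
          - (w - z) * (z * (RtoC (INR n) * z ^ pred n))).
        - unfold e. ring.
        - rewrite E, !Cpow_S, S_INR, RtoC_plus. simpl pred. ring. }
    set (x := RtoC (INR n) * z ^ pred n) in *.
    set (d := Cmod (w - z)).
    assert (Hd : (0 <= d)%R) by apply Cmod_ge_0.
    specialize (Hx n). fold x in Hx.
    assert (T : (Cmod (w * e + (w - z) * (w - z) * x) <= rho * Cmod e + d * d * Cmod x)%R).
    { eapply Rle_trans; [apply Cmod_triangle|]. rewrite !Cmod_mult. fold d.
      apply Rplus_le_compat_r, Rmult_le_compat_r; [apply Cmod_ge_0 | assumption]. }
    fold d in IH. rewrite S_INR. simpl pow in *. rewrite !Rmult_1_r in *.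
    assert (0 <= rho ^ n)%R by now apply pow_le.
    pose proof (pos_INR n).
    assert (T1 : (rho * (rho * rho * Cmod e) <= rho * (INR n * INR n * rho ^ n * (d * d)))%R)
      by now apply Rmult_le_compat_l.
    assert (T2 : (rho * d * d * (rho * Cmod x) <= rho * d * d * (INR n * rho ^ n))%R).
    { apply Rmult_le_compat_l; [|assumption]. repeat apply Rmult_le_pos; assumption. }
    assert (T3 : (0 <= (INR n + 1) * (rho * rho ^ n * (d * d)))%R).
    { repeat apply Rmult_le_pos; lra. }
    assert (T4 : (rho * rho * Cmod (w * e + (w - z) * (w - z) * x)
             <= rho * rho * (rho * Cmod e + d * d * Cmod x))%R).
    { apply Rmult_le_compat_l; [|assumption]. now apply Rmult_le_pos. }
    lra.
Qed.

(** Summing [pow_remainder_le] against the coefficients gives a constant K, the sum of n^2 |a_n|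
    rho^(n-2), that is uniform on the closed disk of radius [rho]. *)
Lemma psum_taylor1 (a : nat -> C) (rho : R) :
  summable_disk a -> (0 < rho < 1)%R ->
  exists K, (0 <= K)%R /\ forall z w, (Cmod z <= rho)%R -> (Cmod w <= rho)%R ->
    (Cmod (psum a w - psum a z - (w - z) * psum (cderive a) z)
     <= K * Cmod (w - z) ^ 2)%R.
Proof.
  intros Ha Hr.
  destruct (summable_disk_euler _ (summable_disk_euler _ Ha) rho) as [K0 HK0]; [lra|].
  assert (HK0' : (0 <= K0)%R).
  { apply (is_series_nonneg _ _) with (2 := HK0).
    intros n. apply Rmult_le_pos; [apply Cmod_ge_0 | apply pow_le; lra]. }
  exists (/ rho ^ 2 * K0)%R. split.
  { apply Rmult_le_pos; [|assumption]. left. apply Rinv_0_lt_compat, pow_lt. lra. }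
  intros z w Hz Hw.
  assert (Hrho : (0 < rho ^ 2)%R) by (apply pow_lt; lra).
  apply (is_csum_norm_le
           (fun n => a n * (w ^ n - z ^ n - (w - z) * (RtoC (INR n) * z ^ pred n))) _
           (fun n => / rho ^ 2 * Cmod (w - z) ^ 2
                     * (Cmod (euler (euler a) n) * rho ^ n))%R).
  (* The derivative series is reindexed to the powers of the original one; its new term at 0
     vanishes. *)
  - assert (Hd : is_csum (fun n => a n * (RtoC (INR n) * z ^ pred n))
                   (psum (cderive a) z)).
    { replace (psum (cderive a) z)
        with (a O * (RtoC (INR 0) * z ^ pred 0) + psum (cderive a) z) by (simpl; ring).
      apply (is_csum_decr (fun n => a n * (RtoC (INR n) * z ^ pred n))).
      eapply is_csum_ext; [|apply psum_correct;
        [now apply summable_disk_cderive | unfold in_disk; lra]].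
      intros n. unfold cderive. simpl pred. ring. }
    eapply is_csum_ext;
      [|exact (is_csum_minus _ _ _ _
          (is_csum_minus _ _ _ _ (psum_correct a w Ha ltac:(unfold in_disk; lra))
             (psum_correct a z Ha ltac:(unfold in_disk; lra)))
          (is_csum_scal (w - z) _ _ Hd))].
    intros n; simpl; ring.
  - intros n. rewrite Cmod_mult. unfold euler.
    rewrite !Cmod_mult, !Cmod_R, !Rabs_pos_eq by apply pos_INR.
    apply Rmult_le_reg_l with (1 := Hrho).
    pose proof (pow_remainder_le z w rho n Hz Hw) as B.
    apply (Rmult_le_compat_l (Cmod (a n)) _ _ (Cmod_ge_0 _)) in B.
    eapply Rle_trans; [|eapply Rle_trans; [exact B|]]; right; [ring|].
    simpl pow. field. lra.
  - replace (/ rho ^ 2 * K0 * Cmod (w - z) ^ 2)%R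
      with (/ rho ^ 2 * Cmod (w - z) ^ 2 * K0)%R by ring.
    exact (is_series_scal (V := R_NormedModule) _ _ _ HK0).
Qed.

(** * Wirtinger derivatives *)

Definition is_curve_derive (f : R -> C) (t : R) (l : C) : Prop :=
  is_derive (fun s => Re (f s)) t (Re l) /\ is_derive (fun s => Im (f s)) t (Im l).

Lemma curve_derive_unique (f : R -> C) (t : R) (l : C) :
  is_curve_derive f t l -> curve_derive f t = l.
Proof.
  intros [H1 H2]. apply Ceq_re_im; simpl; now apply is_derive_unique.
Qed.

Lemma is_curve_derive_ext_loc (f g : R -> C) (t : R) (l : C) :
  locally t (fun s => f s = g s) -> is_curve_derive f t l -> is_curve_derive g t l.
Proof.
  intros E [H1 H2]; split; eapply is_derive_ext_loc; try eassumption;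
    revert E; apply filter_imp; now intros s ->.
Qed.

Lemma is_curve_derive_ext (f g : R -> C) (t : R) (l : C) :
  (forall s, f s = g s) -> is_curve_derive f t l -> is_curve_derive g t l.
Proof. intros E. apply is_curve_derive_ext_loc. now apply filter_forall. Qed.

Lemma is_curve_derive_const (c : C) (t : R) : is_curve_derive (fun _ => c) t 0.
Proof. split; apply (is_derive_const (V := R_NormedModule)). Qed.

Lemma is_curve_derive_plus (f g : R -> C) (t : R) (l m : C) :
  is_curve_derive f t l -> is_curve_derive g t m ->
  is_curve_derive (fun s => f s + g s) t (l + m).
Proof.
  intros [H1 H2] [H3 H4]; split.
  - rewrite re_plus. eapply is_derive_ext; [|exact (is_derive_plus _ _ _ _ _ H1 H3)].
    intros s. now rewrite re_plus.
  - rewrite im_plus. eapply is_derive_ext; [|exact (is_derive_plus _ _ _ _ _ H2 H4)].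
    intros s. now rewrite im_plus.
Qed.

Lemma is_curve_derive_mult (f g : R -> C) (t : R) (l m : C) :
  is_curve_derive f t l -> is_curve_derive g t m ->
  is_curve_derive (fun s => f s * g s) t (l * g t + f t * m).
Proof.
  intros [H1 H2] [H3 H4]; split.
  - replace (Re (l * g t + f t * m))
      with ((Re l * Re (g t) + Re (f t) * Re m) - (Im l * Im (g t) + Im (f t) * Im m))%R
      by (rewrite re_plus, !re_mult; ring).
    eapply is_derive_ext;
      [|exact (is_derive_minus _ _ _ _ _ (Derive.is_derive_mult _ _ _ _ _ H1 H3)
                 (Derive.is_derive_mult _ _ _ _ _ H2 H4))].
    intros s. now rewrite re_mult.
  - replace (Im (l * g t + f t * m))
      with ((Re l * Im (g t) + Re (f t) * Im m) + (Im l * Re (g t) + Im (f t) * Re m))%R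
      by (rewrite im_plus, !im_mult; ring).
    eapply is_derive_ext;
      [|exact (is_derive_plus _ _ _ _ _ (Derive.is_derive_mult _ _ _ _ _ H1 H4)
                 (Derive.is_derive_mult _ _ _ _ _ H2 H3))].
    intros s. now rewrite im_mult.
Qed.

Lemma is_curve_derive_scal (c : C) (f : R -> C) (t : R) (l : C) :
  is_curve_derive f t l -> is_curve_derive (fun s => c * f s) t (c * l).
Proof.
  intros H. replace (c * l) with (0 * f t + c * l) by ring.
  exact (is_curve_derive_mult _ _ _ _ _ (is_curve_derive_const c t) H).
Qed.

Lemma is_curve_derive_conj (f : R -> C) (t : R) (l : C) :
  is_curve_derive f t l -> is_curve_derive (fun s => Cconj (f s)) t (Cconj l).
Proof.
  intros [H1 H2]; split.
  - exact H1.
  - exact (is_derive_opp _ _ _ H2).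
Qed.

Lemma is_curve_derive_RtoC (t : R) : is_curve_derive RtoC t 1.
Proof.
  split; [apply (is_derive_id (K := R_AbsRing))
         | apply (is_derive_const (V := R_NormedModule) 0%R)].
Qed.

(** The square is used because the modulus itself is not differentiable at 0. *)
Lemma is_curve_derive_sqr_Cmod (f : R -> C) (t : R) (l : C) :
  is_curve_derive f t l ->
  is_derive (fun s => Cmod (f s) ^ 2)%R t (2 * (Re (f t) * Re l + Im (f t) * Im l))%R.
Proof.
  intros [H1 H2].
  replace (2 * (Re (f t) * Re l + Im (f t) * Im l))%R
    with ((Re l * Re (f t) + Re (f t) * Re l) + (Im l * Im (f t) + Im (f t) * Im l))%R
    by ring.
  eapply is_derive_ext;
    [|exact (is_derive_plus _ _ _ _ _ (Derive.is_derive_mult _ _ _ _ _ H1 H1)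
               (Derive.is_derive_mult _ _ _ _ _ H2 H2))].
  intros s. rewrite Cmod2_alt. unfold plus; simpl. ring.
Qed.

(** Lets bounds and identities that hold only inside a disk be used near a point of a curve. *)
Lemma curve_locally_disk (f : R -> C) (t : R) (l : C) (rho : R) :
  (0 <= rho)%R -> is_curve_derive f t l -> (Cmod (f t) < rho)%R ->
  locally t (fun s => (Cmod (f s) < rho)%R).
Proof.
  intros Hr H Ht.
  assert (Hc : continuous (fun s => Cmod (f s) ^ 2)%R t).
  { apply (ex_derive_continuous (V := R_NormedModule)). eexists. exact (is_curve_derive_sqr_Cmod _ _ _ H). }
  pose proof (Cmod_ge_0 (f t)).
  assert (Hlt : (Cmod (f t) ^ 2 < rho ^ 2)%R) by (simpl; nra).
  assert (L : locally (Cmod (f t) ^ 2)%R (fun y => (y < rho ^ 2)%R)) by exact (open_lt _ _ Hlt).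
  generalize (Hc _ L). unfold filtermap. apply filter_imp. intros s Hs.
  pose proof (Cmod_ge_0 (f s)). simpl in Hs. nra.
Qed.

Lemma is_derive_squeeze_0 (r q : R -> R) (t : R) :
  locally t (fun s => (Rabs (r s) <= q s)%R) -> q t = 0%R ->
  is_derive q t 0%R -> is_derive r t 0%R.
Proof.
  intros L Hq [_ D].
  assert (Hr : r t = 0%R).
  { pose proof (locally_singleton _ _ L) as B. cbv beta in B. rewrite Hq in B.
    pose proof (Rabs_pos (r t)).
    destruct (Req_dec (r t) 0) as [|N]; [assumption|]. apply Rabs_pos_lt in N. lra. }
  split; [apply is_linear_scal_l|].
  intros x Hx eps.
  assert (x = t) as -> by (symmetry; now apply (is_filter_lim_locally_unique (V := R_NormedModule))).
  specialize (D t Hx eps). generalize (filter_and _ _ L D). apply filter_imp.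
  intros s [B1 B2].
  change (Rabs (q s - q t - (s - t) * 0) <= eps * Rabs (s - t))%R in B2.
  change (Rabs (r s - r t - (s - t) * 0) <= eps * Rabs (s - t))%R.
  rewrite Hr. rewrite Hq in B2.
  replace (r s - 0 - (s - t) * 0)%R with (r s) by ring.
  replace (q s - 0 - (s - t) * 0)%R with (q s) in B2 by ring.
  pose proof (Rle_abs (q s)). lra.
Qed.

(** Along the curve the power sum is its first-order Taylor polynomial at [z] plus a remainder
    bounded by K |f(s) - z|^2. That bound and its derivative vanish at [t], so the remainder has
    derivative 0. *)
Lemma is_curve_derive_psum (a : nat -> C) (f : R -> C) (t : R) (l : C) :
  summable_disk a -> is_curve_derive f t l -> in_disk (f t) ->
  is_curve_derive (fun s => psum a (f s)) t (psum (cderive a) (f t) * l).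
Proof.
  intros Ha Hf Ht. unfold in_disk in Ht.
  set (z := f t) in *. set (d := psum (cderive a) z).
  (* A radius strictly between |z| and 1: the curve stays inside it near [t], and the Taylor
     constant exists there. *)
  set (rho := ((1 + Cmod z) / 2)%R).
  pose proof (Cmod_ge_0 z) as Hz.
  destruct (psum_taylor1 a rho Ha) as [K [HK HT]]; [unfold rho; lra|].
  set (r := fun s => psum a (f s) - psum a z - (f s - z) * d).
  set (q := fun s => (K * Cmod (f s - z) ^ 2)%R).
  assert (Hfz : is_curve_derive (fun s => f s - z) t l).
  { replace l with (l + 0) by ring.
    exact (is_curve_derive_plus _ _ _ _ _ Hf (is_curve_derive_const (- z) t)). }
  assert (Hq0 : (f t - z) = 0) by (unfold z; ring).
  assert (Hq : is_derive q t 0%R).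
  { pose proof (is_derive_scal _ _ K _ (is_curve_derive_sqr_Cmod _ _ _ Hfz)) as B.
    cbv beta in B. rewrite Hq0 in B. simpl Re in B; simpl Im in B.
    match type of B with is_derive _ _ ?x => replace x with 0%R in B end; [exact B|].
    ring. }
  assert (Hq1 : q t = 0%R) by (unfold q; rewrite Hq0, Cmod_0; ring).
  assert (L : locally t (fun s => (Cmod (r s) <= q s)%R)).
  { assert (Hlt : (Cmod (f t) < rho)%R) by (unfold rho; fold z; lra).
    generalize (curve_locally_disk f t l rho ltac:(unfold rho; lra) Hf Hlt).
    apply filter_imp. intros s Hs. exact (HT z (f s) ltac:(unfold rho; lra) (Rlt_le _ _ Hs)). }
  assert (Hr : is_curve_derive r t 0).
  { split; apply is_derive_squeeze_0 with q; try assumption; revert L;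
      apply filter_imp; intros s Hs; eapply Rle_trans; try exact Hs.
    - apply re_le_Cmod.
    - apply im_le_Cmod. }
  replace (d * l) with ((0 + d * l) + 0) by ring.
  eapply is_curve_derive_ext;
    [|exact (is_curve_derive_plus _ _ _ _ _
               (is_curve_derive_plus _ _ _ _ _ (is_curve_derive_const (psum a z) t)
                  (is_curve_derive_scal d _ _ _ Hfz)) Hr)].
  intros s. unfold r. simpl. ring.
Qed.

(* The chain rule along every differentiable curve serves as real
   differentiability. *)
Definition is_wirtinger (F : C -> C) (z u v : C) : Prop :=
  forall (f : R -> C) (t : R) (l : C), f t = z -> is_curve_derive f t l ->
    is_curve_derive (fun s => F (f s)) t (u * l + v * Cconj l).

Lemma is_wirtinger_ext (F G : C -> C) (z u v : C) :
  (forall w, in_disk w -> F w = G w) -> in_disk z ->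
  is_wirtinger F z u v -> is_wirtinger G z u v.
Proof.
  intros E Hz H f t l Ht Hf.
  eapply is_curve_derive_ext_loc; [|exact (H f t l Ht Hf)].
  generalize (curve_locally_disk f t l 1 Rle_0_1 Hf ltac:(rewrite Ht; exact Hz)).
  apply filter_imp. intros s Hs. now apply E.
Qed.

(** Horizontal and vertical lines through [z] have velocities 1 and i, so the partial derivatives
    are u + v and i (u - v); these are solved for u and v. *)
Lemma is_wirtinger_Dz_Dzb (F : C -> C) (z u v : C) :
  is_wirtinger F z u v -> Dz F z = u /\ Dzb F z = v.
Proof.
  intros H.
  assert (Hx : partial_x F z = u + v).
  { apply curve_derive_unique.
    replace (u + v) with (u * 1 + v * Cconj 1) by (rewrite (Cconj_RtoC 1); ring).
    apply H; [now destruct z|]. split; simpl.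
    - apply (is_derive_id (K := R_AbsRing)).
    - apply (is_derive_const (V := R_NormedModule) (Im z)). }
  assert (Hy : partial_y F z = Ci * (u - v)).
  { apply curve_derive_unique.
    replace (Ci * (u - v)) with (u * Ci + v * Cconj Ci) by (rewrite Cconj_Ci; ring).
    apply H; [now destruct z|]. split; simpl.
    - apply (is_derive_const (V := R_NormedModule) (Re z)).
    - apply (is_derive_id (K := R_AbsRing)). }
  unfold Dz, Dzb. rewrite Hx, Hy.
  split.
  - transitivity ((u + v - (Ci * Ci) * (u - v)) / 2); [unfold Cdiv; ring|].
    rewrite Ci_sqr. field.
  - transitivity ((u + v + (Ci * Ci) * (u - v)) / 2); [unfold Cdiv; ring|].
    rewrite Ci_sqr. field.
Qed.

Lemma is_wirtinger_id (z : C) : is_wirtinger (fun w => w) z 1 0.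
Proof. intros f t l _ Hf. now replace (1 * l + 0 * Cconj l) with l by ring. Qed.

Lemma is_wirtinger_const (c z : C) : is_wirtinger (fun _ => c) z 0 0.
Proof.
  intros f t l _ _. replace (0 * l + 0 * Cconj l) with (RtoC 0) by ring.
  apply is_curve_derive_const.
Qed.

Lemma is_wirtinger_plus (F G : C -> C) (z u v u' v' : C) :
  is_wirtinger F z u v -> is_wirtinger G z u' v' ->
  is_wirtinger (fun w => F w + G w) z (u + u') (v + v').
Proof.
  intros H1 H2 f t l Ht Hf.
  replace ((u + u') * l + (v + v') * Cconj l)
    with ((u * l + v * Cconj l) + (u' * l + v' * Cconj l)) by ring.
  apply is_curve_derive_plus; [now apply H1 | now apply H2].
Qed.

Lemma is_wirtinger_mult (F G : C -> C) (z u v u' v' : C) :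
  is_wirtinger F z u v -> is_wirtinger G z u' v' ->
  is_wirtinger (fun w => F w * G w) z (u * G z + F z * u') (v * G z + F z * v').
Proof.
  intros H1 H2 f t l Ht Hf.
  replace ((u * G z + F z * u') * l + (v * G z + F z * v') * Cconj l)
    with ((u * l + v * Cconj l) * G (f t) + F (f t) * (u' * l + v' * Cconj l))
    by (rewrite Ht; ring).
  apply (is_curve_derive_mult (fun s => F (f s)) (fun s => G (f s)));
    [now apply H1 | now apply H2].
Qed.

Lemma is_wirtinger_conj (F : C -> C) (z u v : C) :
  is_wirtinger F z u v -> is_wirtinger (fun w => Cconj (F w)) z (Cconj v) (Cconj u).
Proof.
  intros H f t l Ht Hf.
  replace (Cconj v * l + Cconj u * Cconj l) with (Cconj (u * l + v * Cconj l)).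
  2:{ rewrite Cplus_conj, !Cmult_conj, Cconj_conj. ring. }
  apply is_curve_derive_conj. now apply H.
Qed.

Lemma is_wirtinger_psum (a : nat -> C) (z : C) :
  summable_disk a -> in_disk z -> is_wirtinger (psum a) z (psum (cderive a) z) 0.
Proof.
  intros Ha Hz f t l Ht Hf. subst z.
  replace (psum (cderive a) (f t) * l + 0 * Cconj l)
    with (psum (cderive a) (f t) * l) by ring.
  now apply is_curve_derive_psum.
Qed.

(* Using one [Fzb] for both mixed derivatives builds their symmetry in. *)
Definition twice_wirtinger (F : C -> C) : Prop :=
  exists Fz Fb Fzz Fzb Fbb : C -> C, forall z, in_disk z ->
    is_wirtinger F z (Fz z) (Fb z) /\
    is_wirtinger Fz z (Fzz z) (Fzb z) /\
    is_wirtinger Fb z (Fzb z) (Fbb z).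

Lemma twice_wirtinger_ext (F G : C -> C) :
  (forall w, in_disk w -> F w = G w) -> twice_wirtinger F -> twice_wirtinger G.
Proof.
  intros E (Fz & Fb & Fzz & Fzb & Fbb & H).
  exists Fz, Fb, Fzz, Fzb, Fbb. intros z Hz. destruct (H z Hz) as [H1 H2].
  split; [now apply is_wirtinger_ext with F | exact H2].
Qed.

Lemma twice_wirtinger_const (c : C) : twice_wirtinger (fun _ => c).
Proof.
  exists (fun _ => RtoC 0), (fun _ => RtoC 0), (fun _ => RtoC 0), (fun _ => RtoC 0),
    (fun _ => RtoC 0).
  intros z _. split; [|split]; apply is_wirtinger_const.
Qed.

Lemma twice_wirtinger_id : twice_wirtinger (fun w => w).
Proof.
  exists (fun _ => RtoC 1), (fun _ => RtoC 0), (fun _ => RtoC 0), (fun _ => RtoC 0),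
    (fun _ => RtoC 0).
  intros z _. split; [apply is_wirtinger_id | split; apply is_wirtinger_const].
Qed.

Lemma twice_wirtinger_plus (F G : C -> C) :
  twice_wirtinger F -> twice_wirtinger G -> twice_wirtinger (fun w => F w + G w).
Proof.
  intros (Fz & Fb & Fzz & Fzb & Fbb & HF) (Gz & Gb & Gzz & Gzb & Gbb & HG).
  exists (fun w => Fz w + Gz w), (fun w => Fb w + Gb w), (fun w => Fzz w + Gzz w),
    (fun w => Fzb w + Gzb w), (fun w => Fbb w + Gbb w).
  intros z Hz. destruct (HF z Hz) as (H1 & H2 & H3), (HG z Hz) as (H4 & H5 & H6).
  split; [|split]; now apply is_wirtinger_plus.
Qed.

Lemma twice_wirtinger_mult (F G : C -> C) :
  twice_wirtinger F -> twice_wirtinger G -> twice_wirtinger (fun w => F w * G w).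
Proof.
  intros (Fz & Fb & Fzz & Fzb & Fbb & HF) (Gz & Gb & Gzz & Gzb & Gbb & HG).
  exists (fun w => Fz w * G w + F w * Gz w), (fun w => Fb w * G w + F w * Gb w),
    (fun w => (Fzz w * G w + Fz w * Gz w) + (Fz w * Gz w + F w * Gzz w)),
    (fun w => (Fzb w * G w + Fz w * Gb w) + (Fb w * Gz w + F w * Gzb w)),
    (fun w => (Fbb w * G w + Fb w * Gb w) + (Fb w * Gb w + F w * Gbb w)).
  intros z Hz. destruct (HF z Hz) as (H1 & H2 & H3), (HG z Hz) as (H4 & H5 & H6).
  split; [now apply is_wirtinger_mult|split].
  - apply is_wirtinger_plus; now apply is_wirtinger_mult.
  (* The product rule yields the two mixed derivatives with their middle terms exchanged; reordering
     lets one witness serve for both. *)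
  - replace ((Fzb z * G z + Fz z * Gb z) + (Fb z * Gz z + F z * Gzb z))
      with ((Fzb z * G z + Fb z * Gz z) + (Fz z * Gb z + F z * Gzb z)) by ring.
    apply is_wirtinger_plus; now apply is_wirtinger_mult.
Qed.

Lemma twice_wirtinger_conj (F : C -> C) :
  twice_wirtinger F -> twice_wirtinger (fun w => Cconj (F w)).
Proof.
  intros (Fz & Fb & Fzz & Fzb & Fbb & H).
  exists (fun w => Cconj (Fb w)), (fun w => Cconj (Fz w)), (fun w => Cconj (Fbb w)),
    (fun w => Cconj (Fzb w)), (fun w => Cconj (Fzz w)).
  intros z Hz. destruct (H z Hz) as (H1 & H2 & H3).
  split; [|split]; now apply is_wirtinger_conj.
Qed.

Lemma twice_wirtinger_pow (F : C -> C) (n : nat) :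
  twice_wirtinger F -> twice_wirtinger (fun w => F w ^ n).
Proof.
  intros H. induction n as [|n IH]; [apply (twice_wirtinger_const 1)|].
  exact (twice_wirtinger_mult _ _ H IH).
Qed.

Lemma twice_wirtinger_psum (a : nat -> C) : summable_disk a -> twice_wirtinger (psum a).
Proof.
  intros Ha.
  exists (psum (cderive a)), (fun _ => RtoC 0), (psum (cderive (cderive a))),
    (fun _ => RtoC 0), (fun _ => RtoC 0).
  intros z Hz. split; [now apply is_wirtinger_psum|split].
  - apply is_wirtinger_psum; [now apply summable_disk_cderive | exact Hz].
  - apply is_wirtinger_const.
Qed.

(** * Polar coordinates and angular derivatives *)

Lemma Cmod_polar (r t : R) : (0 <= r)%R -> Cmod (polar r t) = r.
Proof.
  intros Hr. unfold Cmod, polar; simpl.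
  replace (_ + _)%R with (r * r * (Rsqr (sin t) + Rsqr (cos t)))%R by (unfold Rsqr; ring).
  rewrite sin2_cos2, Rmult_1_r. now apply sqrt_square.
Qed.

Lemma polar_exists (z : C) : exists t, z = polar (Cmod z) t.
Proof.
  destruct (Ceq_dec z 0) as [->|Hz].
  { exists 0%R. unfold polar. rewrite Cmod_0. apply Ceq_re_im; simpl; ring. }
  apply Cmod_gt_0 in Hz. set (r := Cmod z) in *.
  assert (Hb : (-1 <= Re z / r <= 1)%R).
  { apply Rabs_le_between.
    unfold Rdiv. rewrite Rabs_mult, Rabs_inv, (Rabs_pos_eq r) by lra.
    apply Rmult_le_reg_r with r; [lra|].
    rewrite Rmult_assoc, Rinv_l by lra. pose proof (re_le_Cmod z). fold r in H. lra. }
  assert (HC : (r * cos (acos (Re z / r)))%R = Re z) by (rewrite cos_acos by lra; field; lra).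
  assert (HS : (r * sin (acos (Re z / r)))%R = Rabs (Im z)).
  { rewrite sin_acos by lra.
    rewrite <- (sqrt_square r) at 1 by lra. rewrite <- sqrt_mult_alt by nra.
    rewrite <- sqrt_Rsqr_abs. f_equal.
    assert (r * r = Re z * Re z + Im z * Im z)%R.
    { pose proof (Cmod2_alt z) as B. fold r in B. simpl in B. lra. }
    unfold Rsqr. transitivity (r * r - Re z * Re z)%R; [field|]; lra. }
  (* [acos] returns an angle with nonnegative sine, so the lower half-plane takes the opposite
     angle. *)
  destruct (Rle_dec 0 (Im z)) as [H|H].
  - exists (acos (Re z / r)). unfold polar. rewrite HC, HS, Rabs_pos_eq by assumption.
    now apply Ceq_re_im.
  - exists (- acos (Re z / r))%R. unfold polar.
    rewrite cos_neg, sin_neg, <- Ropp_mult_distr_r, HC, HS, Rabs_left by lra.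
    apply Ceq_re_im; simpl; ring.
Qed.

Lemma is_curve_derive_polar (r t : R) :
  is_curve_derive (polar r) t (Ci * polar r t).
Proof.
  split; simpl.
  - replace (0 * (r * cos t) - 1 * (r * sin t))%R with (r * - sin t)%R by ring.
    apply (is_derive_scal cos), is_derive_cos.
  - replace (0 * (r * sin t) + 1 * (r * cos t))%R with (r * cos t)%R by ring.
    apply (is_derive_scal sin), is_derive_sin.
Qed.

(** On a circle z moves with velocity i z, so d/dtheta of F is i (z F_z - conj(z) F_zb).
    Differentiating the bracket again, each of its two terms contributes one mixed derivative -i
    |z|^2 F_zb_z, whence the factor 2. By uniqueness of derivatives these expressions equal [d1] and
    [d2], however those were obtained; [d1] is needed on the whole circle because it is
    differentiated in turn. *)
Lemma angular_derivatives (F : C -> C) (r t : R) (d1 : R -> C) (d2 : C) :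
  twice_wirtinger F -> (0 <= r < 1)%R ->
  (forall s, is_curve_derive (fun s => F (polar r s)) s (Ci * d1 s)) ->
  is_curve_derive d1 t (Ci * d2) ->
  let z := polar r t in
  z * Dz F z - Cconj z * Dzb F z = d1 t /\
  z * Dz F z + z ^ 2 * Dz (Dz F) z - 2 * RtoC (Cmod z ^ 2) * Dzb (Dz F) z
    + Cconj z * Dzb F z + Cconj z ^ 2 * Dzb (Dzb F) z = d2.
Proof.
  intros (Fz & Fb & Fzz & Fzb & Fbb & H) Hr H1 H2 z.
  assert (Hd : forall s, in_disk (polar r s)).
  { intros s. unfold in_disk. rewrite Cmod_polar; lra. }
  assert (EF : forall w, in_disk w -> Dz F w = Fz w /\ Dzb F w = Fb w).
  { intros w Hw. apply is_wirtinger_Dz_Dzb, H, Hw. }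
  destruct (H z (Hd t)) as (_ & HFz & HFb).
  assert (E1 : Dz (Dz F) z = Fzz z /\ Dzb (Dz F) z = Fzb z).
  { apply is_wirtinger_Dz_Dzb, is_wirtinger_ext with Fz; [|apply Hd|exact HFz].
    intros w Hw. symmetry. now apply EF. }
  assert (E2 : Dz (Dzb F) z = Fzb z /\ Dzb (Dzb F) z = Fbb z).
  { apply is_wirtinger_Dz_Dzb, is_wirtinger_ext with Fb; [|apply Hd|exact HFb].
    intros w Hw. symmetry. now apply EF. }
  assert (Ci_cancel : forall x y, Ci * x = Ci * y -> x = y).
  { intros x y E. replace x with (- (Ci * (Ci * x))) by (rewrite Cmult_assoc, Ci_sqr; ring).
    rewrite E, Cmult_assoc, Ci_sqr. ring. }
  assert (Hd1 : forall s, polar r s * Fz (polar r s) - Cconj (polar r s) * Fb (polar r s) = d1 s).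
  { intros s. apply Ci_cancel. rewrite <- (curve_derive_unique _ _ _ (H1 s)).
    symmetry. apply curve_derive_unique.
    match goal with |- is_curve_derive _ _ ?x =>
      replace x with (Fz (polar r s) * (Ci * polar r s)
                      + Fb (polar r s) * Cconj (Ci * polar r s)) end.
    - apply (proj1 (H _ (Hd s))); [reflexivity | apply is_curve_derive_polar].
    - rewrite Cmult_conj, Cconj_Ci. ring. }
  destruct (EF z (Hd t)) as [-> ->]. destruct E1 as [-> ->], E2 as [_ ->].
  split; [apply Hd1|].
  apply Ci_cancel. rewrite <- (curve_derive_unique _ _ _ H2).
  symmetry. apply curve_derive_unique.
  eapply is_curve_derive_ext; [exact Hd1|].
  pose proof (is_curve_derive_polar r t) as P.
  pose proof (HFz (polar r) t _ eq_refl P) as Q1.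
  pose proof (HFb (polar r) t _ eq_refl P) as Q2.
  pose proof (is_curve_derive_plus _ _ _ _ _ (is_curve_derive_mult _ _ _ _ _ P Q1)
    (is_curve_derive_scal (-1) _ _ _
       (is_curve_derive_mult _ _ _ _ _ (is_curve_derive_conj _ _ _ P) Q2))) as Q.
  cbv beta in Q. fold z in Q.
  rewrite Cmod2_conj.
  match type of Q with is_curve_derive _ _ ?x =>
    match goal with |- is_curve_derive _ _ ?y => replace y with x end end.
  - eapply is_curve_derive_ext; [|exact Q]. intros s; simpl; ring.
  - rewrite Cmult_conj, Cconj_Ci. ring.
Qed.

(** * Hadamard products *)

Lemma has_expansion_re_im (f : C -> C) (w : C -> C) (a : nat -> C) (t : R) :
  (forall t : R, w (RtoC t) = RtoC t) -> has_expansion w f a -> (Rabs t < 1)%R ->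
  is_pseries (fun n => Re (a n)) t (Re (f (RtoC t))) /\
  is_pseries (fun n => Im (a n)) t (Im (f (RtoC t))).
Proof.
  intros Hw H Ht.
  assert (Hd : in_disk (RtoC t)) by (unfold in_disk; now rewrite Cmod_R).
  specialize (H _ Hd). rewrite Hw in H.
  destruct (proj1 (is_pseries_csum _ _ _) H) as [H1 H2].
  split; apply is_pseries_R.
  - eapply is_series_ext; [|exact H1]. intros n. cbv beta.
    now rewrite <- RtoC_pow, re_scal_r.
  - eapply is_series_ext; [|exact H2]. intros n. cbv beta.
    now rewrite <- RtoC_pow, im_scal_r.
Qed.

(** Convergence at 1/2 bounds the terms there and so makes both radii of convergence positive; equal
    sums near 0 then force equal coefficients. *)
Lemma pseries_eq_coeff (u v : nat -> R) (phi : R -> R) :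
  (forall t, (Rabs t < 1)%R -> is_pseries u t (phi t)) ->
  (forall t, (Rabs t < 1)%R -> is_pseries v t (phi t)) ->
  forall n, u n = v n.
Proof.
  assert (CV : forall s, (forall t, (Rabs t < 1)%R -> is_pseries s t (phi t)) ->
            Rbar_lt 0 (CV_radius s)).
  { intros s H. apply Rbar_lt_le_trans with (/ 2)%R; [simpl; lra|].
    apply (proj1 (CV_radius_bounded s)).
    assert (Ht : (Rabs (/ 2) < 1)%R) by (rewrite Rabs_pos_eq; lra).
    apply (ex_series_terms_bounded (fun n => s n * (/ 2) ^ n)%R).
    exists (phi (/ 2)%R). exact (proj1 (is_pseries_R _ _ _) (H _ Ht)). }
  intros Hu Hv n. apply PSeries_ext_recip; [now apply CV | now apply CV|].
  exists (mkposreal 1 Rlt_0_1). intros t Ht.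
  change (Rabs (t - 0) < 1)%R in Ht. rewrite Rminus_0_r in Ht.
  transitivity (phi t); [|symmetry]; apply is_pseries_unique; [now apply Hu | now apply Hv].
Qed.

(** The identity and [Cconj] both fix the real axis. Restricting to it reduces both kinds of
    expansion to two real power series, one for each component. *)
Lemma has_expansion_unique (w : C -> C) (f : C -> C) (a b : nat -> C) :
  (forall t : R, w (RtoC t) = RtoC t) ->
  has_expansion w f a -> has_expansion w f b -> forall n, a n = b n.
Proof.
  intros Hw Ha Hb n. apply Ceq_re_im.
  - exact (pseries_eq_coeff _ _ (fun t => Re (f (RtoC t)))
             (fun t Ht => proj1 (has_expansion_re_im f w a t Hw Ha Ht))
             (fun t Ht => proj1 (has_expansion_re_im f w b t Hw Hb Ht)) n).
  - exact (pseries_eq_coeff _ _ (fun t => Im (f (RtoC t)))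
             (fun t Ht => proj2 (has_expansion_re_im f w a t Hw Ha Ht))
             (fun t Ht => proj2 (has_expansion_re_im f w b t Hw Hb Ht)) n).
Qed.

Lemma coeffs_unique (w : C -> C) (f : C -> C) (a : nat -> C) (n : nat) :
  (forall t : R, w (RtoC t) = RtoC t) -> has_expansion w f a -> coeffs w f n = a n.
Proof.
  intros Hw Ha. apply (has_expansion_unique w f); [exact Hw | | exact Ha].
  unfold coeffs. apply epsilon_spec. now exists a.
Qed.

Lemma convolution_in_expansion (w : C -> C) (f g : C -> C) (a c : nat -> C) (z : C) :
  (forall t : R, w (RtoC t) = RtoC t) ->
  has_expansion w f a -> has_expansion w g c ->
  convolution_in w f g z = CSeries (fun n => a n * c n * w z ^ n).
Proof.
  intros Hw Ha Hc. apply CSeries_ext. intros n.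
  now rewrite (coeffs_unique w f a), (coeffs_unique w g c).
Qed.

Lemma has_expansion_conj (f : C -> C) (a : nat -> C) :
  has_expansion (fun z => z) f a ->
  has_expansion Cconj (fun z => Cconj (f z)) (fun n => Cconj (a n)).
Proof.
  intros H z Hz. apply is_pseries_csum.
  eapply is_csum_ext; [|apply is_csum_conj, is_pseries_csum, H, Hz].
  intros n. simpl. now rewrite Cmult_conj, Cpow_conj.
Qed.

(** Coefficients of (A z + B z^2) / (1 - z)^3, since z / (1 - z)^3 and z^2 / (1 - z)^3 have
    coefficients n (n + 1) / 2 and n (n - 1) / 2. *)
Definition kernel_coeff (A B : C) (n : nat) : C :=
  (A * RtoC (INR n * (INR n + 1)) + B * RtoC (INR n * (INR n - 1))) / 2.

Lemma summable_disk_one : summable_disk (fun _ => 1).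
Proof.
  intros rho Hr. eapply ex_series_ext; [|apply (ex_series_geom rho)].
  - intros n. simpl. now rewrite Cmod_1, Rmult_1_l.
  - rewrite Rabs_pos_eq; lra.
Qed.

Lemma in_disk_neq_1 (z : C) : in_disk z -> 1 - z <> 0.
Proof.
  intros Hz E. apply Ceq_minus in E. unfold in_disk in Hz.
  rewrite <- E, Cmod_1 in Hz. lra.
Qed.

Lemma psum_plus (a b : nat -> C) (z : C) :
  summable_disk a -> summable_disk b -> in_disk z ->
  psum (fun n => a n + b n) z = psum a z + psum b z.
Proof.
  intros Ha Hb Hz. apply CSeries_unique.
  eapply is_csum_ext;
    [|exact (is_csum_plus _ _ _ _ (psum_correct a z Ha Hz) (psum_correct b z Hb Hz))].
  intros n; simpl; ring.
Qed.

Lemma psum_scal (c : C) (a : nat -> C) (z : C) :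
  summable_disk a -> in_disk z -> psum (fun n => c * a n) z = c * psum a z.
Proof.
  intros Ha Hz. apply CSeries_unique.
  eapply is_csum_ext; [|exact (is_csum_scal c _ _ (psum_correct a z Ha Hz))].
  intros n; simpl; ring.
Qed.

Lemma psum_ext (a b : nat -> C) (z : C) : (forall n, a n = b n) -> psum a z = psum b z.
Proof. intros E. apply CSeries_ext. intros n. now rewrite E. Qed.

(* Shifting the index gives linear equations for the sums s0, s1, s2 of z^n,
   n z^n, n^2 z^n: s0 = 1 + z s0, s1 = z (s1 + s0), s2 = z (s2 + 2 s1 + s0). *)
Lemma kernel_expansion (A B z : C) :
  in_disk z ->
  is_pseries (K := C_AbsRing) (V := C_NormedModule) (kernel_coeff A B) z
    ((A * z + B * z ^ 2) / (1 - z) ^ 3).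
Proof.
  intros Hz. apply is_pseries_csum.
  set (one := fun _ : nat => RtoC 1).
  pose proof summable_disk_one as S0. fold one in S0.
  pose proof (summable_disk_euler _ S0) as S1.
  pose proof (summable_disk_euler _ S1) as S2.
  assert (E0 : psum one z = 1 + z * psum one z).
  { exact (psum_decr one z S0 Hz). }
  assert (E1 : psum (euler one) z = z * (psum (euler one) z + psum one z)).
  { assert (E : forall n, euler one n + one n = euler one (S n)).
    { intros n. unfold euler, one. rewrite S_INR, RtoC_plus. ring. }
    rewrite <- psum_plus, (psum_ext _ _ z E), psum_decr by assumption || exact (summable_disk_cderive _ S0).
    unfold euler at 1. simpl INR. ring. }
  assert (E2 : psum (euler (euler one)) z
               = z * (psum (euler (euler one)) z + (2 * psum (euler one) z + psum one z))).
  { assert (E : forall n, euler (euler one) n + (2 * euler one n + one n)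
                          = euler (euler one) (S n)).
    { intros n. unfold euler, one. rewrite S_INR, RtoC_plus. ring. }
    rewrite <- psum_scal by assumption.
    rewrite <- (psum_plus (fun n => 2 * euler one n) one)
      by (try apply summable_disk_scal; assumption).
    rewrite <- psum_plus; [|assumption| |assumption].
    2:{ apply summable_disk_plus; [now apply summable_disk_scal | assumption]. }
    rewrite (psum_ext _ _ z E), psum_decr; [|exact (summable_disk_cderive _ S1) | exact Hz].
    unfold euler at 1. simpl INR. ring. }
  pose proof (in_disk_neq_1 z Hz) as N1.
  assert (V0 : psum one z = / (1 - z)).
  (* Solves the shift equation: subtract z times the unknown sum and divide by 1 - z. *)
  { apply (f_equal (fun x => (x - z * psum one z) / (1 - z))) in E0.
    transitivity ((psum one z - z * psum one z) / (1 - z)); [field; assumption|].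
    rewrite E0. field. assumption. }
  assert (V1 : psum (euler one) z = z / (1 - z) ^ 2).
  { apply (f_equal (fun x => (x - z * psum (euler one) z) / (1 - z))) in E1.
    transitivity ((psum (euler one) z - z * psum (euler one) z) / (1 - z));
      [field; assumption|].
    rewrite E1, V0. field. assumption. }
  assert (V2 : psum (euler (euler one)) z = (z + z ^ 2) / (1 - z) ^ 3).
  { apply (f_equal (fun x => (x - z * psum (euler (euler one)) z) / (1 - z))) in E2.
    transitivity ((psum (euler (euler one)) z - z * psum (euler (euler one)) z) / (1 - z));
      [field; assumption|].
    rewrite E2, V0, V1. field. assumption. }
  (* Regrouping by powers of n: A n (n + 1) + B n (n - 1) = (A + B) n^2 + (A - B) n. *)
  replace ((A * z + B * z ^ 2) / (1 - z) ^ 3)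
    with ((A + B) / 2 * psum (euler (euler one)) z + (A - B) / 2 * psum (euler one) z)
    by (rewrite V1, V2; field; assumption).
  eapply is_csum_ext;
    [|exact (is_csum_plus _ _ _ _ (is_csum_scal ((A + B) / 2) _ _ (psum_correct _ z S2 Hz))
               (is_csum_scal ((A - B) / 2) _ _ (psum_correct _ z S1 Hz)))].
  intros n. unfold kernel_coeff, euler, one. simpl.
  rewrite !RtoC_mult, RtoC_plus, RtoC_minus. field.
Qed.

(** * Polyharmonic sums *)

Lemma sum_1_to_0 (u : nat -> C) : sum_1_to 0 u = 0.
Proof. unfold sum_1_to. now rewrite sum_n_m_zero by lia. Qed.

Lemma sum_1_to_S (p : nat) (u : nat -> C) : sum_1_to (S p) u = sum_1_to p u + u (S p).
Proof. unfold sum_1_to. rewrite sum_n_Sm by lia. reflexivity. Qed.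

Lemma sum_1_to_ext (p : nat) (u v : nat -> C) :
  (forall k, (1 <= k <= p)%nat -> u k = v k) -> sum_1_to p u = sum_1_to p v.
Proof. apply sum_n_m_ext_loc. Qed.

Lemma sum_1_to_plus (p : nat) (u v : nat -> C) :
  sum_1_to p (fun k => u k + v k) = sum_1_to p u + sum_1_to p v.
Proof. exact (sum_n_m_plus u v 1 p). Qed.

Lemma sum_1_to_scal (p : nat) (c : C) (u : nat -> C) :
  sum_1_to p (fun k => c * u k) = c * sum_1_to p u.
Proof. exact (sum_n_m_mult_l (K := C_Ring) c u 1 p). Qed.

Lemma is_curve_derive_sum_1_to (p : nat) (f : R -> nat -> C) (t : R) (l : nat -> C) :
  (forall k, (1 <= k <= p)%nat -> is_curve_derive (fun s => f s k) t (l k)) ->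
  is_curve_derive (fun s => sum_1_to p (f s)) t (sum_1_to p l).
Proof.
  induction p as [|p IH]; intros H.
  - rewrite sum_1_to_0. eapply is_curve_derive_ext; [|apply (is_curve_derive_const 0)].
    intros s. now rewrite sum_1_to_0.
  - rewrite sum_1_to_S.
    eapply is_curve_derive_ext;
      [|apply is_curve_derive_plus; [apply IH; intros; apply H; lia | apply (H (S p)); lia]].
    intros s. now rewrite sum_1_to_S.
Qed.

Lemma twice_wirtinger_sum_1_to (p : nat) (f : C -> nat -> C) :
  (forall k, (1 <= k <= p)%nat -> twice_wirtinger (fun z => f z k)) ->
  twice_wirtinger (fun z => sum_1_to p (f z)).
Proof.
  induction p as [|p IH]; intros H.
  - eapply twice_wirtinger_ext; [|apply (twice_wirtinger_const 0)].
    intros z _. now rewrite sum_1_to_0.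
  - eapply twice_wirtinger_ext;
      [|apply twice_wirtinger_plus; [apply IH; intros; apply H; lia | apply (H (S p)); lia]].
    intros z _. now rewrite sum_1_to_S.
Qed.

(** Taking coefficients as arguments keeps this class closed under -i d/dtheta, so one
    differentiation rule applied twice gives D and N. *)
Definition polysum (p : nat) (a b : nat -> nat -> C) (z : C) : C :=
  sum_1_to p (fun k =>
    RtoC (Cmod z ^ (2 * (k - 1))) * (psum (a k) z + Cconj (psum (b k) z))).

Definition summable_upto (p : nat) (a : nat -> nat -> C) : Prop :=
  forall k, (1 <= k <= p)%nat -> summable_disk (a k).

Lemma twice_wirtinger_polysum (p : nat) (a b : nat -> nat -> C) :
  summable_upto p a -> summable_upto p b -> twice_wirtinger (polysum p a b).
Proof.
  intros Ha Hb. apply twice_wirtinger_sum_1_to. intros k Hk.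
  apply twice_wirtinger_mult.
  (* Written as a power of z conj(z), the weight is visibly smooth, even at the origin. *)
  - apply twice_wirtinger_ext with (fun z => (z * Cconj z) ^ (k - 1)).
    { intros z _. now rewrite pow_mult, RtoC_pow, Cmod2_conj. }
    apply twice_wirtinger_pow, twice_wirtinger_mult; [apply twice_wirtinger_id|].
    apply twice_wirtinger_conj, twice_wirtinger_id.
  - apply twice_wirtinger_plus.
    + now apply twice_wirtinger_psum, Ha.
    + now apply twice_wirtinger_conj, twice_wirtinger_psum, Hb.
Qed.

(* -i d/dtheta multiplies the coefficient of [Cconj z ^ n] by [-n]. *)
Definition opp_euler (b : nat -> C) (n : nat) : C := RtoC (-1) * euler b n.

Lemma summable_disk_opp_euler (b : nat -> C) :
  summable_disk b -> summable_disk (opp_euler b).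
Proof. intros H. now apply summable_disk_scal, summable_disk_euler. Qed.

Lemma psum_opp_euler (b : nat -> C) (z : C) :
  summable_disk b -> in_disk z -> psum (opp_euler b) z = - (z * psum (cderive b) z).
Proof.
  intros Hb Hz. unfold opp_euler. rewrite psum_scal, psum_euler; try assumption.
  - ring.
  - now apply summable_disk_euler.
Qed.

Lemma is_curve_derive_polysum_polar (p : nat) (a b : nat -> nat -> C) (r t : R) :
  summable_upto p a -> summable_upto p b -> (0 <= r < 1)%R ->
  is_curve_derive (fun s => polysum p a b (polar r s)) t
    (Ci * polysum p (fun k => euler (a k)) (fun k => opp_euler (b k)) (polar r t)).
Proof.
  intros Ha Hb Hr.
  assert (Hd : in_disk (polar r t)) by (unfold in_disk; rewrite Cmod_polar; lra).
  unfold polysum at 2. rewrite <- sum_1_to_scal.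
  apply is_curve_derive_sum_1_to. intros k Hk.
  rewrite psum_euler, psum_opp_euler by (try apply Ha; try apply Hb; assumption).
  eapply is_curve_derive_ext.
  { intros s. rewrite Cmod_polar by lra. reflexivity. }
  rewrite Cmod_polar by lra.
  pose proof (is_curve_derive_polar r t) as P.
  pose proof (is_curve_derive_scal (RtoC (r ^ (2 * (k - 1)))) _ _ _
    (is_curve_derive_plus _ _ _ _ _ (is_curve_derive_psum _ _ _ _ (Ha k Hk) P Hd)
       (is_curve_derive_conj _ _ _ (is_curve_derive_psum _ _ _ _ (Hb k Hk) P Hd)))) as Q.
  match type of Q with is_curve_derive _ _ ?x =>
    match goal with |- is_curve_derive _ _ ?y => replace y with x end end; [exact Q|].
  rewrite Copp_conj, !Cmult_conj, Cconj_Ci. ring.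
Qed.

(** * Behaviour at the origin along a ray *)

Lemma summable_disk_shift (a : nat -> C) :
  summable_disk a -> summable_disk (fun n => a (S n)).
Proof.
  intros Ha. apply summable_disk_le with (2 := summable_disk_cderive _ Ha) (K := 1%R).
  intros n. unfold cderive. rewrite Cmod_mult, Cmod_R, Rabs_pos_eq by apply pos_INR.
  rewrite S_INR. pose proof (pos_INR n). pose proof (Cmod_ge_0 (a (S n))). nra.
Qed.

Lemma polysum_0 (p : nat) (a b : nat -> nat -> C) :
  (1 <= p)%nat -> summable_upto p a -> summable_upto p b ->
  polysum p a b 0 = a 1%nat O + Cconj (b 1%nat O).
Proof.
  intros Hp Ha Hb.
  assert (H0 : in_disk 0) by (unfold in_disk; rewrite Cmod_0; lra).
  assert (E : forall c, summable_disk c -> psum c 0 = c O).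
  { intros c Hc. rewrite psum_decr; [ring|now apply summable_disk_shift|exact H0]. }
  destruct p as [|p]; [lia|]. clear Hp.
  unfold polysum. induction p as [|p IH].
  (* For k = 1 the weight is 0^0 = 1; every later weight vanishes at the origin. *)
  - rewrite sum_1_to_S, sum_1_to_0, !E by (apply Ha || apply Hb; lia). simpl. ring.
  - rewrite sum_1_to_S, IH.
    + replace (2 * (S (S p) - 1))%nat with (S (2 * p + 1)) by lia.
      rewrite Cmod_0. simpl pow. rewrite Rmult_0_l. ring.
    + intros k Hk. apply Ha. lia.
    + intros k Hk. apply Hb. lia.
Qed.

(** For a series without constant term, the sum at t z is t times the sum at t z of the coefficients
    [shift_scal z a]. Keeping the fixed z in the coefficients leaves only the real factor t outside,
    common to the analytic and the conjugate part. *)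
Definition shift_scal (c : C) (a : nat -> C) (n : nat) : C := c * a (S n).

Lemma summable_upto_shift_scal (p : nat) (c : C) (a : nat -> nat -> C) :
  summable_upto p a -> summable_upto p (fun k => shift_scal c (a k)).
Proof. intros H k Hk. now apply summable_disk_scal, summable_disk_shift, H. Qed.

Lemma polysum_ray (p : nat) (a b : nat -> nat -> C) (z : C) (t : R) :
  summable_upto p a -> summable_upto p b ->
  (forall k, (1 <= k <= p)%nat -> a k O = 0 /\ b k O = 0) ->
  in_disk (RtoC t * z) ->
  polysum p a b (RtoC t * z)
  = RtoC t * polysum p (fun k => shift_scal z (a k)) (fun k => shift_scal z (b k))
               (RtoC t * z).
Proof.
  intros Ha Hb H0 Hz. unfold polysum. rewrite <- sum_1_to_scal.
  apply sum_1_to_ext. intros k Hk. destruct (H0 k Hk) as [Ea Eb].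
  unfold shift_scal.
  rewrite !psum_scal by (try apply summable_disk_shift; try apply Ha; try apply Hb; assumption).
  rewrite (psum_decr (a k)), (psum_decr (b k)), Ea, Eb
    by (try apply summable_disk_shift; try apply Ha; try apply Hb; assumption).
  rewrite !Cplus_0_l, !Cmult_conj, (Cconj_RtoC t). ring.
Qed.

(** Re (x / y) = Re (x conj(y)) / |y|^2 turns the complex quotient into a quotient of differentiable
    real functions. *)
Lemma continuity_Re_div (f g : R -> C) (t : R) (l m : C) :
  is_curve_derive f t l -> is_curve_derive g t m -> g t <> 0 ->
  continuity_pt (fun s => Re (f s / g s)) t.
Proof.
  intros Hf Hg Hn.
  assert (E : forall x y, (Re (x * Cconj y) / Cmod y ^ 2)%R = Re (x / y)).
  { intros x y. rewrite Cmod2_alt. unfold Re, Im. simpl. unfold Rdiv. ring. }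
  set (q := fun s => (Re (f s * Cconj (g s)) / Cmod (g s) ^ 2)%R).
  apply continuity_pt_ext with q.
  { intros s. apply E. }
  assert (Hg2 : (Cmod (g t) ^ 2)%R <> 0%R).
  { apply Cmod_gt_0 in Hn. apply Rgt_not_eq, pow_lt, Hn. }
  apply continuity_pt_filterlim, (ex_derive_continuous (V := R_NormedModule) q).
  eexists.
  exact (is_derive_div _ _ _ _ _
           (proj1 (is_curve_derive_mult _ _ _ _ _ Hf (is_curve_derive_conj _ _ _ Hg)))
           (is_curve_derive_sqr_Cmod _ _ _ Hg) Hg2).
Qed.

(* The equation says [xi (w - 1) = - (w + 1)], so |w - 1| = |w + 1|. *)
Lemma Re_zero_cayley (w : C) :
  Re w = 0%R <-> exists xi, Cmod xi = 1%R /\ (1 + xi) * w + (1 - xi) = 0.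
Proof.
  split.
  - intros Hw.
    assert (Hn : 1 - w <> 0).
    { intros E. apply (f_equal Re) in E. simpl in E. unfold Re in Hw. lra. }
    (* The solution of the equation for xi; its modulus is 1 because 1 + w and 1 - w are opposite
       conjugates up to sign: both have the same distance to 0 when w is imaginary. *)
    exists ((1 + w) / (1 - w)). split; [|now field].
    rewrite Cmod_div by assumption.
    assert (Cmod (1 + w) = Cmod (1 - w)) as ->.
    { unfold Cmod. f_equal. unfold Re in Hw. simpl. rewrite Hw. ring. }
    apply Rinv_r. apply Rgt_not_eq. now apply Cmod_gt_0.
  - intros (xi & H1 & H2).
    assert (E : Cmod (1 + w) = Cmod (w - 1)).
    { replace (1 + w) with (- (xi * (w - 1))).
      - rewrite Cmod_opp, Cmod_mult, H1. ring.
      - transitivity ((1 + w) - ((1 + xi) * w + (1 - xi))); [ring|]. rewrite H2. ring. }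
    apply (f_equal (fun x => x ^ 2)%R) in E. rewrite !Cmod2_alt in E.
    simpl in E. unfold Re. lra.
Qed.

(** With A and B the two kernel constants, (A + B) / 2 = 1 + xi and (A - B) / 2 = (1 - xi) - beta (1
    + xi). The conjugate kernel has A and B exchanged, which flips the sign of its linear
    coefficient only. This is the sign of [opp_euler], which cancels when applied twice. *)
Lemma convolution_terms (beta : R) (h g : C -> C) (a b : nat -> C) (z xi : C) :
  has_expansion (fun z => z) h a -> has_expansion (fun z => z) g b -> in_disk z ->
  convolution h
    (fun w => ((2 - beta * xi - beta) * w + (2 * xi + beta * xi + beta) * w ^ 2)
              / (1 - w) ^ 3) z
  + conj_convolution (fun w => Cconj (g w))
      (fun w => ((2 * xi + beta * xi + beta) * Cconj w
                 + (2 - beta * xi - beta) * Cconj w ^ 2) / (1 - Cconj w) ^ 3) z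
  = (1 + xi) * (psum (euler (euler a)) z + Cconj (psum (opp_euler (opp_euler b)) z))
    + ((1 - xi) - beta * (1 + xi)) * (psum (euler a) z + Cconj (psum (opp_euler b) z)).
Proof.
  intros Hh Hg Hz.
  set (A := 2 - beta * xi - beta). set (B := 2 * xi + beta * xi + beta).
  set (mu := (1 - xi) - beta * (1 + xi)).
  pose proof (expansion_summable _ _ Hh) as Sa.
  pose proof (expansion_summable _ _ Hg) as Sb.
  pose proof (summable_disk_euler _ Sa) as Sa1.
  pose proof (summable_disk_euler _ Sa1) as Sa2.
  pose proof (summable_disk_opp_euler _ Sb) as Sb1.
  pose proof (summable_disk_opp_euler _ Sb1) as Sb2.
  unfold convolution, conj_convolution.
  rewrite (convolution_in_expansion _ h _ a (kernel_coeff A B) z).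
  2: reflexivity. 2: exact Hh.
  2:{ intros w Hw. now apply kernel_expansion. }
  rewrite (convolution_in_expansion Cconj _ _ (fun n => Cconj (b n)) (kernel_coeff B A) z).
  2: exact Cconj_RtoC. 2: now apply has_expansion_conj.
  2:{ intros w Hw. apply kernel_expansion. unfold in_disk. now rewrite Cmod_conj. }
  rewrite (CSeries_unique _ ((1 + xi) * psum (euler (euler a)) z + mu * psum (euler a) z)).
  2:{ eapply is_csum_ext;
        [|exact (is_csum_plus _ _ _ _ (is_csum_scal (1 + xi) _ _ (psum_correct _ z Sa2 Hz))
            (is_csum_scal mu _ _ (psum_correct _ z Sa1 Hz)))].
      intros n. unfold kernel_coeff, euler, mu, A, B. simpl.
      rewrite !RtoC_mult, RtoC_plus, RtoC_minus. field. }
  rewrite (CSeries_unique _ ((1 + xi) * Cconj (psum (opp_euler (opp_euler b)) z)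
                             + mu * Cconj (psum (opp_euler b) z))).
  2:{ eapply is_csum_ext;
        [|exact (is_csum_plus _ _ _ _
            (is_csum_scal (1 + xi) _ _ (is_csum_conj _ _ (psum_correct _ z Sb2 Hz)))
            (is_csum_scal mu _ _ (is_csum_conj _ _ (psum_correct _ z Sb1 Hz))))].
      intros n. unfold kernel_coeff, opp_euler, euler, mu, A, B. cbv beta.
      rewrite !Cmult_conj, !Cconj_RtoC, Cpow_conj.
      rewrite !RtoC_mult, RtoC_plus, RtoC_minus. field. }
  ring.
Qed.

(* Along the ray [t z] the quotient tends to 1 at the origin, where the linear
   term of [F] dominates; by the intermediate value theorem it stays on one
   side of [beta] as soon as it avoids it. *)
Lemma ray_gt (p : nat) (a b a' b' : nat -> nat -> C) (beta : R) (z : C) :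
  (1 <= p)%nat -> (beta < 1)%R ->
  summable_upto p a -> summable_upto p b -> summable_upto p a' -> summable_upto p b' ->
  (forall k, (1 <= k <= p)%nat -> a k O = 0 /\ b k O = 0) ->
  (forall k, (1 <= k <= p)%nat -> a' k O = 0 /\ b' k O = 0) ->
  a 1%nat 1%nat = 1 -> b 1%nat 1%nat = 0 -> a' 1%nat 1%nat = 1 -> b' 1%nat 1%nat = 0 ->
  (forall w, in_disk w -> w <> 0 -> polysum p a' b' w <> 0) ->
  (forall w, in_disk w -> w <> 0 -> Re (polysum p a b w / polysum p a' b' w) <> beta) ->
  in_disk z -> z <> 0 -> (beta < Re (polysum p a b z / polysum p a' b' z))%R.
Proof.
  intros Hp Hbeta Ha Hb Ha' Hb' H0 H0' a1 b1 a1' b1' HD HN Hz Hz0.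
  pose proof (proj1 (Cmod_gt_0 z) Hz0) as Hz1.
  assert (Hd : forall t, (0 <= t <= 1)%R -> in_disk (RtoC t * z)).
  { intros t Ht. unfold in_disk in *. rewrite Cmod_mult, Cmod_R, Rabs_pos_eq by lra. nra. }
  assert (Hnz : forall t, (0 < t)%R -> RtoC t * z <> 0).
  { intros t Ht. apply Cmult_neq_0; [|assumption]. intros E. apply RtoC_inj in E. lra. }
  set (num := polysum p (fun k => shift_scal z (a k)) (fun k => shift_scal z (b k))).
  set (den := polysum p (fun k => shift_scal z (a' k)) (fun k => shift_scal z (b' k))).
  assert (Rn : forall t, (0 <= t <= 1)%R -> polysum p a b (t * z) = t * num (t * z)).
  { intros t Ht. apply polysum_ray; auto. }
  assert (Rd : forall t, (0 <= t <= 1)%R -> polysum p a' b' (t * z) = t * den (t * z)).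
  { intros t Ht. apply polysum_ray; auto. }
  assert (Z0 : RtoC 0 * z = 0) by ring.
  assert (num0 : num (RtoC 0 * z) = z).
  { rewrite Z0. unfold num. rewrite polysum_0; try apply summable_upto_shift_scal; try assumption.
    unfold shift_scal. rewrite a1, b1, Cmult_0_r, (Cconj_RtoC 0). ring. }
  assert (den0 : den (RtoC 0 * z) = z).
  { rewrite Z0. unfold den. rewrite polysum_0; try apply summable_upto_shift_scal; try assumption.
    unfold shift_scal. rewrite a1', b1', Cmult_0_r, (Cconj_RtoC 0). ring. }
  assert (Dn : forall t, (0 <= t <= 1)%R -> den (RtoC t * z) <> 0).
  { intros t Ht. destruct (Req_dec t 0) as [->|N]; [now rewrite den0|].
    intros E. apply (HD (RtoC t * z)); [now apply Hd | apply Hnz; lra|].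
    rewrite Rd, E by assumption. ring. }
  assert (Q : forall t, (0 < t <= 1)%R ->
    polysum p a b (t * z) / polysum p a' b' (t * z) = num (t * z) / den (t * z)).
  { intros t Ht. rewrite Rn, Rd by lra. field. split; [apply Dn; lra|].
    intros E. apply RtoC_inj in E. lra. }
  (* The sign makes q negative at 0, as the intermediate value theorem requires. *)
  set (q := fun t : R => (beta - Re (num (t * z)%C / den (t * z)%C)%C)%R).
  assert (q0 : (q 0 < 0)%R).
  { unfold q. rewrite num0, den0. unfold Cdiv. rewrite Cinv_r by assumption. simpl. lra. }
  (* Differentiability is two-sided even at t = 0 and t = 1, because the closed segment lies in the
     open disk. *)
  assert (Hray : forall G t, twice_wirtinger G -> (0 <= t <= 1)%R ->
            exists l, is_curve_derive (fun s => G (RtoC s * z)) t l).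
  { intros G t (Gz & Gb & Gzz & Gzb & Gbb & HG) Ht. eexists.
    exact (proj1 (HG _ (Hd t Ht)) (fun s => RtoC s * z) t _ eq_refl
             (is_curve_derive_mult _ _ _ _ _ (is_curve_derive_RtoC t)
                (is_curve_derive_const z t))). }
  assert (qc : forall t, (0 <= t <= 1)%R -> continuity_pt q t).
  { intros t Ht.
    destruct (Hray num t) as [l Hl]; [|assumption|].
    { apply twice_wirtinger_polysum; now apply summable_upto_shift_scal. }
    destruct (Hray den t) as [m Hm]; [|assumption|].
    { apply twice_wirtinger_polysum; now apply summable_upto_shift_scal. }
    apply continuity_pt_minus; [apply continuity_pt_const; now intros ? ?|].
    apply (continuity_Re_div _ _ _ _ _ Hl Hm). now apply Dn. }
  assert (E1 : RtoC 1 * z = z) by ring.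
  pose proof (Q 1%R ltac:(lra)) as Q1. rewrite E1 in Q1. rewrite Q1.
  destruct (Rlt_le_dec beta (Re (num z / den z))) as [|Hle]; [assumption|exfalso].
  assert (Hne : Re (num z / den z) <> beta).
  { rewrite <- Q1. now apply HN. }
  assert (q1 : (0 < q 1)%R) by (unfold q; rewrite E1; lra).
  destruct (Ranalysis5.IVT_interv q 0 1 qc Rlt_0_1 q0 q1) as [t [Ht Hqt]].
  assert (t <> 0%R) by (intros ->; lra).
  apply (HN (RtoC t * z)); [now apply Hd | apply Hnz; lra|].
  rewrite Q by lra. unfold q in Hqt. lra.
Qed.

Theorem theorem3 :
  forall (p : nat) (beta : R) (F : C -> C) (h g : nat -> C -> C)
         (a b : nat -> nat -> C),
    (1 <= p)%nat ->
    (0 <= beta < 1)%R ->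
    in_H0 p F h g a b ->
    univalent F ->
    Dtheta_nonvanishing F ->
    (convex_of_order p beta F
     <->
     forall z xi : C,
       in_disk z -> z <> RtoC 0 -> Cmod xi = 1%R ->
       sum_1_to p (fun k =>
         (RtoC (Cmod z ^ (2 * (k - 1))) *
          (convolution (h k)
             (fun w =>
                ((2 - beta * xi - beta) * w
                 + (2 * xi + beta * xi + beta) * w ^ 2) / (1 - w) ^ 3) z
           + conj_convolution (fun w => Cconj (g k w))
               (fun w =>
                ((2 * xi + beta * xi + beta) * Cconj w
                 + (2 - beta * xi - beta) * Cconj w ^ 2)
                / (1 - Cconj w) ^ 3) z))%C)
       <> RtoC 0).
Proof.
  intros p beta F h g a b Hp Hbeta [(Hpoly & Hexp & HF & a11 & _) [b11 _]] Huni Htheta.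
  assert (Sa : summable_upto p a).
  { intros k Hk. apply (expansion_summable (h k)). now apply Hexp. }
  assert (Sb : summable_upto p b).
  { intros k Hk. apply (expansion_summable (g k)). now apply Hexp. }
  set (a1 := fun k => euler (a k)). set (b1 := fun k => opp_euler (b k)).
  set (a2 := fun k => euler (a1 k)). set (b2 := fun k => opp_euler (b1 k)).
  assert (Sa1 : summable_upto p a1) by (intros k Hk; now apply summable_disk_euler, Sa).
  assert (Sb1 : summable_upto p b1) by (intros k Hk; now apply summable_disk_opp_euler, Sb).
  assert (Sa2 : summable_upto p a2) by (intros k Hk; now apply summable_disk_euler, Sa1).
  assert (Sb2 : summable_upto p b2) by (intros k Hk; now apply summable_disk_opp_euler, Sb1).
  set (N := polysum p a2 b2). set (D := polysum p a1 b1).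
  assert (HFS : forall z, in_disk z -> polysum p a b z = F z).
  { intros z Hz. rewrite HF by assumption. apply sum_1_to_ext. intros k Hk.
    destruct (Hexp k Hk) as (_ & _ & Hh & Hg).
    now rewrite (psum_unique _ _ _ Hh Hz), (psum_unique _ _ _ Hg Hz). }
  assert (HF1 : forall r s, (0 <= r < 1)%R ->
            is_curve_derive (fun s => F (polar r s)) s (Ci * D (polar r s))).
  { intros r s Hr.
    eapply is_curve_derive_ext; [|now apply is_curve_derive_polysum_polar].
    intros s'. apply HFS. unfold in_disk. rewrite Cmod_polar; lra. }
  (* The angular derivative of F is i D, so D inherits its nonvanishing. *)
  assert (HD : forall z, in_disk z -> z <> 0 -> D z <> 0).
  { intros z Hz Hz0 E. destruct (polar_exists z) as [t Ht].
    pose proof (proj1 (Cmod_gt_0 z) Hz0). unfold in_disk in Hz.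
    apply (Htheta (Cmod z) t); [lra|].
    rewrite (curve_derive_unique _ _ _ (HF1 (Cmod z) t ltac:(lra))), <- Ht, E. ring. }
  assert (HT : forall z, in_disk z -> tangent_rotation F z = Re (N z / D z)).
  { intros z Hz. destruct (polar_exists z) as [t Ht].
    pose proof (Cmod_ge_0 z). unfold in_disk in Hz.
    destruct (angular_derivatives F (Cmod z) t (fun s => D (polar (Cmod z) s)) (N z))
      as [E1 E2]; [|lra| | |].
    - apply twice_wirtinger_ext with (1 := HFS). now apply twice_wirtinger_polysum.
    - intros s. apply HF1. lra.
    (* The same angular rule, now for the coefficients [a1] and [b1] of D. *)
    - replace (N z) with (N (polar (Cmod z) t)) by now rewrite <- Ht.
      apply is_curve_derive_polysum_polar; (assumption || lra).
    - rewrite <- Ht in E1, E2. unfold tangent_rotation. now rewrite E1, E2. }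
  assert (HC : forall z xi, in_disk z ->
       sum_1_to p (fun k =>
         (RtoC (Cmod z ^ (2 * (k - 1))) *
          (convolution (h k)
             (fun w =>
                ((2 - beta * xi - beta) * w
                 + (2 * xi + beta * xi + beta) * w ^ 2) / (1 - w) ^ 3) z
           + conj_convolution (fun w => Cconj (g k w))
               (fun w =>
                ((2 * xi + beta * xi + beta) * Cconj w
                 + (2 - beta * xi - beta) * Cconj w ^ 2)
                / (1 - Cconj w) ^ 3) z))%C)
       = (1 + xi) * N z + ((1 - xi) - beta * (1 + xi)) * D z).
  { intros z xi Hz. unfold N, D, polysum.
    rewrite <- !sum_1_to_scal, <- sum_1_to_plus. apply sum_1_to_ext. intros k Hk.
    destruct (Hexp k Hk) as (_ & _ & Hh & Hg).
    rewrite (convolution_terms beta (h k) (g k) (a k) (b k)) by assumption.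
    unfold a2, b2, a1, b1. ring. }
  assert (HQ : forall z xi, in_disk z -> z <> 0 ->
     (1 + xi) * N z + ((1 - xi) - beta * (1 + xi)) * D z
     = D z * ((1 + xi) * (N z / D z - beta) + (1 - xi))).
  { intros z xi Hz Hz0. field. now apply HD. }
  split.
  - intros (_ & _ & _ & _ & Hconv) z xi Hz Hz0 Hxi. rewrite HC, HQ by assumption.
    (* If the other factor vanished, [Re_zero_cayley] would make N / D - beta imaginary, against the
       strict inequality. *)
    apply Cmult_neq_0; [now apply HD|]. intros E.
    specialize (Hconv z Hz Hz0). rewrite HT in Hconv by assumption.
    assert (Re (N z / D z - beta) = 0%R).
    { apply Re_zero_cayley. now exists xi. }
    unfold Cminus in H. rewrite re_plus, re_opp, re_RtoC in H. lra.
  - intros H. split; [assumption|split; [assumption|split; [|split; [assumption|]]]].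
    + rewrite <- HFS by (unfold in_disk; rewrite Cmod_0; lra).
      rewrite polysum_0 by assumption.
      destruct (Hexp 1%nat) as (-> & -> & _); [lia|].
      rewrite (Cconj_RtoC 0). ring.
    + intros z Hz Hz0. rewrite HT by assumption. apply Rlt_gt.
      apply ray_gt; try assumption; try lra.
      * intros k Hk. unfold a2, b2, a1, b1, opp_euler, euler. simpl INR.
        split; ring.
      * intros k Hk. unfold a1, b1, opp_euler, euler. simpl INR. split; ring.
      * unfold a2, a1, euler. rewrite a11. simpl INR. ring.
      * unfold b2, b1, opp_euler, euler. rewrite b11. ring.
      * unfold a1, euler. rewrite a11. simpl INR. ring.
      * unfold b1, opp_euler, euler. rewrite b11. ring.
      (* Were the value beta taken at w, N / D - beta would be imaginary there, and the xi that
         [Re_zero_cayley] supplies would annihilate the convolution sum. *)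
      * intros w Hw Hw0 E.
        destruct (proj1 (Re_zero_cayley (N w / D w - beta))) as (xi & Hxi & Hxi0).
        { unfold Cminus. rewrite re_plus, re_opp, re_RtoC. unfold N, D. lra. }
        apply (H w xi Hw Hw0 Hxi). rewrite HC, HQ, Hxi0 by assumption. ring.
Qed.
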